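(* Let $\Omega$ be an angular domain of opening $\pi/\alpha$, and let $f$ be a slice regular function on $\Omega$, continuous on $\overline{\Omega}$, of order $\rho<\alpha$. If there exists $M\ge0$ such that $|f|\le M$ on $\partial\Omega$, then $|f|\le M$ on $\Omega$.
   Context: $\mathbb{H}$ denotes the quaternions with Euclidean norm $|q|$; $\mathbb{S}=\{ix_1+jx_2+kx_3: x_1^2+x_2^2+x_3^2=1\}$; for $I\in\mathbb{S}$, $L_I=\mathbb{R}+\mathbb{R}I$, $e^{I\vartheta}=\cos\vartheta+I\sin\vartheta$, and $\Omega_I=\Omega\cap L_I$. A function $f:\Omega\to\mathbb{H}$ on an open set $\Omega$ is slice regular if for every $I\in\mathbb{S}$ its restriction $f_I$ to $\Omega_I$ satisfies $\frac12\left(\frac{\partial}{\partial x}+I\frac{\partial}{\partial y}\right)f_I(x+yI)=0$. A domain $\Omega$ is a slice domain if $\Omega\cap\mathbb{R}\ne\emptyset$ and each $\Omega_I$ is a domain in $L_I$. A slice domain $\Omega$ is an angular domain if for every $I\in\mathbb{S}$, $\Omega_I=\{re^{I(\zeta_I+\vartheta)}: r>0,\ |\vartheta|<\varphi_I/2\}$ for some $\zeta_I\in\mathbb{R}$, $0<\varphi_I<2\pi$; its opening is $\sup_{I\in\mathbb{S}}\varphi_I$. For $f$ slice regular on $\Omega$ and continuous up to the boundary, $M_f(r,\Omega)=\max\{|f(q)|: q\in\overline\Omega,\ |q|=r\}$ and the order of $f$ is $\rho=\limsup_{r\to+\infty}\frac{\ln^+\ln^+M_f(r,\Omega)}{\ln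 r}$, where $\ln^+x=\max\{\ln x,0\}$. *)

(* Defs.v *)
From Stdlib Require Import Reals.
Open Scope R_scope.

Record quat := mkQ { qr : R; qi : R; qj : R; qk : R }.

Definition qzero : quat := mkQ 0 0 0 0.
Definition qofR (x : R) : quat := mkQ x 0 0 0.
Definition qadd (p q : quat) : quat :=
  mkQ (qr p + qr q) (qi p + qi q) (qj p + qj q) (qk p + qk q).
Definition qopp (p : quat) : quat := mkQ (- qr p) (- qi p) (- qj p) (- qk p).
Definition qsub (p q : quat) : quat := qadd p (qopp q).
Definition qscal (a : R) (p : quat) : quat :=
  mkQ (a * qr p) (a * qi p) (a * qj p) (a * qk p).
Definition qmul (p q : quat) : quat :=
  mkQ (qr p * qr q - qi p * qi q - qj p * qj q - qk p * qk q)
      (qr p * qi q + qi p * qr q + qj p * qk q - qk p * qj q)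
      (qr p * qj q - qi p * qk q + qj p * qr q + qk p * qi q)
      (qr p * qk q + qi p * qj q - qj p * qi q + qk p * qr q).
Definition qnorm (p : quat) : R :=
  sqrt (qr p ^ 2 + qi p ^ 2 + qj p ^ 2 + qk p ^ 2).
Definition qdist (p q : quat) : R := qnorm (qsub p q).

Definition in_S (I : quat) : Prop :=
  qr I = 0 /\ qi I ^ 2 + qj I ^ 2 + qk I ^ 2 = 1.

Definition slice_pt (I : quat) (x y : R) : quat := qadd (qofR x) (qscal y I).

Definition r2dist (p q : R * R) : R :=
  sqrt ((fst p - fst q) ^ 2 + (snd p - snd q) ^ 2).

Definition is_open {X : Type} (d : X -> X -> R) (U : X -> Prop) : Prop :=
  forall x, U x -> exists e, 0 < e /\ forall y, d x y < e -> U y.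

Definition is_connected {X : Type} (d : X -> X -> R) (A : X -> Prop) : Prop :=
  forall U V : X -> Prop, is_open d U -> is_open d V ->
    (forall x, A x -> U x \/ V x) ->
    (exists x, A x /\ U x) -> (exists x, A x /\ V x) ->
    exists x, A x /\ U x /\ V x.

Definition is_domain {X : Type} (d : X -> X -> R) (A : X -> Prop) : Prop :=
  (exists x, A x) /\ is_open d A /\ is_connected d A.

Definition slice_domain (Om : quat -> Prop) : Prop :=
  is_domain qdist Om /\
  (exists x : R, Om (qofR x)) /\
  (forall I, in_S I ->
     is_domain r2dist (fun p : R * R => Om (slice_pt I (fst p) (snd p)))).

(** Angular domain with opening [op] = sup_I phi_I.
    Omega_I = { r e^{I(zeta_I + theta)} : r > 0, |theta| < phi_I / 2 },
    where r e^{I t} = r cos t + I r sin t. *)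
Definition angular_domain (Om : quat -> Prop) (op : R) : Prop :=
  slice_domain Om /\
  exists zeta phi : quat -> R,
    (forall I, in_S I ->
       0 < phi I < 2 * PI) /\
    (forall I, in_S I -> forall x y,
       Om (slice_pt I x y) <->
       exists r th, 0 < r /\ Rabs th < phi I / 2 /\
         slice_pt I x y = slice_pt I (r * cos (zeta I + th)) (r * sin (zeta I + th))) /\
    is_lub (fun v => exists I, in_S I /\ v = phi I) op.

Definition qderiv (h : R -> quat) (t : R) (d : quat) : Prop :=
  derivable_pt_lim (fun s => qr (h s)) t (qr d) /\
  derivable_pt_lim (fun s => qi (h s)) t (qi d) /\
  derivable_pt_lim (fun s => qj (h s)) t (qj d) /\
  derivable_pt_lim (fun s => qk (h s)) t (qk d).

Definition slice_regular (Om : quat -> Prop) (f : quat -> quat) : Prop :=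
  is_open qdist Om /\
  forall I, in_S I -> forall x y, Om (slice_pt I x y) ->
    exists dx dy,
      qderiv (fun s => f (slice_pt I s y)) x dx /\
      qderiv (fun s => f (slice_pt I x s)) y dy /\
      qscal (1/2) (qadd dx (qmul I dy)) = qzero.

Definition closure (Om : quat -> Prop) (q : quat) : Prop :=
  forall e, 0 < e -> exists p, Om p /\ qdist p q < e.
Definition boundary (Om : quat -> Prop) (q : quat) : Prop :=
  closure Om q /\ ~ Om q.

Definition continuous_on (A : quat -> Prop) (f : quat -> quat) : Prop :=
  forall q, A q -> forall e, 0 < e -> exists d, 0 < d /\
    forall p, A p -> qdist p q < d -> qdist (f p) (f q) < e.

Definition is_max_modulus (f : quat -> quat) (Om : quat -> Prop) (r m : R) : Prop :=
  (exists q, closure Om q /\ qnorm q = r /\ qnorm (f q) = m) /\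
  (forall q, closure Om q -> qnorm q = r -> qnorm (f q) <= m).

(** ln^+ x = max(ln x, 0)  (taken 0 for x <= 0) *)
Definition lnp (x : R) : R := if Rle_dec x 1 then 0 else ln x.

Definition is_limsup_infty (g : R -> R) (rho : R) : Prop :=
  (forall e, 0 < e -> exists R0, forall r, R0 < r -> g r < rho + e) /\
  (forall e, 0 < e -> forall R0, exists r, R0 < r /\ rho - e < g r).

Definition has_order (f : quat -> quat) (Om : quat -> Prop) (rho : R) : Prop :=
  exists Mf : R -> R,
    (forall r, 0 < r -> is_max_modulus f Om r (Mf r)) /\
    is_limsup_infty (fun r => lnp (lnp (Mf r)) / ln r) rho.

(* Main.v *)
(** On a slice [L_I] the function [f] is only assumed continuous with partial derivatives satisfying
    the Cauchy-Riemann equation, so Morera's property is a Looman-Menchoff theorem. It is proved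
    without measure theory, by showing that the circulation around every rectangle is at most [eps]
    times its area. If the set of points near which this fails were nonempty, by Baire some portion of
    it would have uniform difference quotients, so the field would be nearly linear along the axes
    through its points. A rectangle each of whose sides meets this portion then has circulation
    [O(e (w + h)^2)], which is fine for bounded eccentricity; an elongated one is cut into columns,
    each shrunk to the hull of the portion, and this halves the defect at every round.

    Cauchy's formula on squares then gives a maximum principle for real parts, and the scalar
    Phragmen-Lindelof theorem follows with the barrier [exp (- del z^bet)], [rho < bet < alpha].
    It is applied to [<f, w> + i <f, I w>], where [w] is the value of [f] at the given point. *)

From Stdlib Require Import Reals Lra Lia Classical ClassicalEpsilon.
From Coquelicot Require Import Coquelicot.
Require Import Defs.
Open Scope R_scope.

(** * Compactness in the plane *)

(** What survives is a Cauchy condition on the axis-wise difference quotients, which is closed in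
    the base point and therefore suits Baire's theorem. A bound by [eps] times the area is the right
    local notion because both sides add up under subdivision: rectangles missing the exceptional set
    inherit it. The halving comes from the form of the error. Cutting a long rectangle into columns
    no wider than tall lowers the total of the squared half-perimeters. The maximum principle avoids
    the identity theorem: among all maximum points in the sector one farthest from the origin is
    chosen, and a small linear perturbation makes that maximum strict. Bounding a real part
    suffices, because [<f, w>] equals [|w|^2] at the given point while the complex function built
    from [w] has modulus at most [|f| |w|]; so [|w|^2 <= M |w|]. *)

Lemma lebesgue_number (a b c d : R) (P : R -> R -> R -> Prop) :
  (forall x y, a <= x <= b -> c <= y <= d -> exists e, 0 < e /\ P x y e) ->
  exists e, 0 < e /\ forall x y, a <= x <= b -> c <= y <= d ->
    exists u v r, a <= u <= b /\ c <= v <= d /\ e <= r /\ P u v r /\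
      Rabs (x - u) < r /\ Rabs (y - v) < r.
Proof.
  intros H.
  assert (H' : forall x y, exists e : posreal, a <= x <= b -> c <= y <= d -> P x y e).
  { intros x y. destruct (classic (a <= x <= b /\ c <= y <= d)) as [[Hx Hy]|N].
    - destruct (H x y Hx Hy) as [e [He HP]]. exists (mkposreal e He). auto.
    (* A default radius: centres outside the rectangle are never selected. *)
    - exists (mkposreal 1 Rlt_0_1). tauto. }
  set (delta := fun x y => proj1_sig (constructive_indefinite_description _ (H' x y))).
  destruct (compactness_value_2d a b c d delta) as [e He].
  exists e. split; [apply cond_pos|].
  intros x y Hx Hy. destruct (NNPP _ (He x y Hx Hy)) as (u & v & Hu & Hv & H1 & H2 & H3).
  exists u, v, (delta u v). repeat split; try tauto.
  unfold delta in *. destruct (constructive_indefinite_description _ (H' u v)). simpl in *. auto.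
Qed.

(** Weierstrass's theorem for upper semicontinuity relative to a compact [K]. One covering bounds
    [F], a second one shows that the supremum is attained. *)
Lemma closed_max (a b c d : R) (K : R -> R -> Prop) (F : R -> R -> R) :
  (forall x y, K x y -> a <= x <= b /\ c <= y <= d) ->
  (forall x y, ~ K x y -> exists e, 0 < e /\
     forall x' y', Rabs (x' - x) < e -> Rabs (y' - y) < e -> ~ K x' y') ->
  (forall x y, K x y -> forall e, 0 < e -> exists r, 0 < r /\
     forall x' y', K x' y' -> Rabs (x' - x) < r -> Rabs (y' - y) < r -> F x' y' < F x y + e) ->
  (exists x y, K x y) ->
  exists x y, K x y /\ forall x' y', K x' y' -> F x' y' <= F x y.
Proof.
  intros Hb Hc Hu [x0 [y0 H0]].
  (* The radius at a point is kept below [1 / (|F| + 1)], so a Lebesgue number bounds [F]. *)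
  destruct (lebesgue_number a b c d (fun x y e =>
     (K x y -> e * (Rabs (F x y) + 1) <= 1) /\
     forall x' y', K x' y' -> Rabs (x' - x) < e -> Rabs (y' - y) < e ->
       K x y /\ F x' y' < F x y + 1)) as [e [He HL]].
  { intros x y _ _. destruct (classic (K x y)) as [k|k].
    - destruct (Hu x y k 1 Rlt_0_1) as [r [Hr H]].
      assert (Hp : 0 < Rabs (F x y) + 1) by (pose proof (Rabs_pos (F x y)); lra).
      exists (Rmin r (/ (Rabs (F x y) + 1))). split.
      { apply Rmin_pos; auto. now apply Rinv_0_lt_compat. }
      split.
      { intros _. apply Rle_trans with (/ (Rabs (F x y) + 1) * (Rabs (F x y) + 1)).
        - apply Rmult_le_compat_r; [lra|apply Rmin_r].
        - rewrite Rinv_l; lra. }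
      intros x' y' k' h1 h2. split; auto. apply H; auto;
        eapply Rlt_le_trans; eauto; apply Rmin_l.
    - destruct (Hc x y k) as [r [Hr H]]. exists r. split; auto. split; [tauto|].
      intros x' y' k' h1 h2. now destruct (H x' y' h1 h2). }
  assert (Hbd : forall x y, K x y -> F x y <= / e + 1).
  { intros x y k. destruct (Hb x y k) as [hx hy].
    destruct (HL x y hx hy) as (u & v & r & _ & _ & her & [h1 h2] & h3 & h4).
    destruct (h2 x y k h3 h4) as [k' hF]. specialize (h1 k').
    assert (Rabs (F u v) + 1 <= / e).
    { pose proof (Rabs_pos (F u v)).
      apply Rmult_le_reg_l with e; auto. rewrite Rinv_r by lra. nra. }
    pose proof (Rle_abs (F u v)). lra. }
  destruct (completeness (fun z => exists x y, K x y /\ z = F x y)) as [m [Hm1 Hm2]].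
  { exists (/ e + 1). intros z (x & y & k & ->). auto. }
  { exists (F x0 y0), x0, y0; auto. }
  apply NNPP. intros N.
  assert (Hlt : forall x y, K x y -> F x y < m).
  { intros x y k. destruct (Rlt_or_le (F x y) m) as [h|h]; auto. exfalso. apply N.
    exists x, y. split; auto. intros x' y' k'. apply Rle_trans with m; auto.
    apply Hm1. now exists x', y'. }
  (* If the supremum [m] were not attained, [F] would stay below [m] by a positive amount near each
     point; a Lebesgue number makes this amount uniform. *)
  destruct (lebesgue_number a b c d (fun x y e =>
     forall x' y', K x' y' -> Rabs (x' - x) < e -> Rabs (y' - y) < e ->
       F x' y' <= m - e)) as [g [Hg HG]].
  { intros x y _ _. destruct (classic (K x y)) as [k|k].
    - pose proof (Hlt x y k). destruct (Hu x y k ((m - F x y) / 2)) as [r [Hr H1]]; [lra|].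
      exists (Rmin r ((m - F x y) / 2)). split; [apply Rmin_pos; lra|].
      intros x' y' k' h1 h2. pose proof (Rmin_l r ((m - F x y) / 2)).
      pose proof (Rmin_r r ((m - F x y) / 2)).
      specialize (H1 x' y' k' ltac:(lra) ltac:(lra)). lra.
    - destruct (Hc x y k) as [r [Hr H]]. exists r. split; auto.
      intros x' y' k' h1 h2. now destruct (H x' y' h1 h2). }
  assert (m <= m - g); [|lra].
  apply Hm2. intros z (x & y & k & ->). destruct (Hb x y k) as [hx hy].
  destruct (HG x y hx hy) as (u & v & r & _ & _ & her & h1 & h3 & h4).
  specialize (h1 x y k h3 h4). lra.
Qed.

(** * The Looman-Menchoff theorem *)

(* The integral of [q dx + p dy] counterclockwise around the rectangle. *)
Definition circ (p q : R -> R -> R) (a b c d : R) : R :=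
  RInt (fun y => p b y - p a y) c d - RInt (fun x => q x d - q x c) a b.

Definition cont_rect (p : R -> R -> R) (a b c d : R) : Prop :=
  forall x y, a <= x <= b -> c <= y <= d -> continuity_2d_pt p x y.

Lemma cont_rect_sub p a b c d a' b' c' d' :
  cont_rect p a b c d -> a <= a' -> b' <= b -> c <= c' -> d' <= d -> cont_rect p a' b' c' d'.
Proof. intros H ? ? ? ? x y ? ?. apply H; lra. Qed.

Lemma continuity_2d_pt_l p x y : continuity_2d_pt p x y -> continuous (fun s => p s y) x.
Proof.
  intros H. apply continuity_pt_filterlim. intros e He.
  destruct (H (mkposreal e He)) as [r Hr]. exists r. split; [apply cond_pos|].
  intros s [_ Hs]. apply Hr; [exact Hs|]. rewrite Rminus_diag, Rabs_R0. apply cond_pos.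
Qed.

Lemma continuity_2d_pt_r p x y : continuity_2d_pt p x y -> continuous (fun s => p x s) y.
Proof.
  intros H. apply continuity_pt_filterlim. intros e He.
  destruct (H (mkposreal e He)) as [r Hr]. exists r. split; [apply cond_pos|].
  intros s [_ Hs]. apply Hr; [|exact Hs]. rewrite Rminus_diag, Rabs_R0. apply cond_pos.
Qed.

Lemma ex_RInt_row p a b c d y s t :
  cont_rect p a b c d -> c <= y <= d -> a <= s -> s <= t -> t <= b -> ex_RInt (fun x => p x y) s t.
Proof.
  intros H ? ? ? ?. apply (ex_RInt_continuous (V := R_CompleteNormedModule)). intros z.
  rewrite Rmin_left, Rmax_right by lra. intros. apply continuity_2d_pt_l, H; lra.
Qed.

Lemma ex_RInt_col p a b c d x s t :
  cont_rect p a b c d -> a <= x <= b -> c <= s -> s <= t -> t <= d -> ex_RInt (fun y => p x y) s t.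
Proof.
  intros H ? ? ? ?. apply (ex_RInt_continuous (V := R_CompleteNormedModule)). intros z.
  rewrite Rmin_left, Rmax_right by lra. intros. apply continuity_2d_pt_r, H; lra.
Qed.

(** Reflection in the diagonal. Combined with exchanging [p] and [q] it reverses the orientation, so
    results about columns transfer to rows. *)
Definition tr {T : Type} (p : R -> R -> T) : R -> R -> T := fun x y => p y x.

Lemma cont_rect_tr p a b c d : cont_rect p a b c d -> cont_rect (tr p) c d a b.
Proof.
  intros H x y Hx Hy e. destruct (H y x Hy Hx e) as [r Hr]. exists r. intros u v ? ?. apply Hr; auto.
Qed.

Lemma circ_tr p q a b c d : circ (tr q) (tr p) c d a b = - circ p q a b c d.
Proof. unfold circ, tr. ring. Qed.

(** Stated with integrability on the sides only, so that it also applies to a field with a pole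
    inside the rectangle. *)
Lemma circ_chasles_x p q a m b c d :
  ex_RInt (fun y => p a y) c d -> ex_RInt (fun y => p m y) c d -> ex_RInt (fun y => p b y) c d ->
  ex_RInt (fun x => q x d - q x c) a m -> ex_RInt (fun x => q x d - q x c) m b ->
  circ p q a b c d = circ p q a m c d + circ p q m b c d.
Proof.
  intros Ea Em Eb E1 E2. unfold circ.
  rewrite <- (RInt_Chasles (fun x => q x d - q x c) a m b) by auto.
  assert (F : forall s t, ex_RInt (fun y => p s y) c d -> ex_RInt (fun y => p t y) c d ->
    RInt (fun y => p t y - p s y) c d = RInt (fun y => p t y) c d - RInt (fun y => p s y) c d).
  { intros. apply (RInt_minus (V := R_CompleteNormedModule)); auto. }
  rewrite !F by auto. change plus with Rplus. ring.
Qed.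

Lemma circ_split_x p q a m b c d :
  cont_rect p a b c d -> cont_rect q a b c d -> a <= m -> m <= b -> c <= d ->
  circ p q a b c d = circ p q a m c d + circ p q m b c d.
Proof.
  intros Hp Hq ? ? ?.
  apply circ_chasles_x.
  1-3: apply (ex_RInt_col p a b c d); [exact Hp|lra..].
  all: apply (ex_RInt_minus (V := R_NormedModule)); apply (ex_RInt_row q a b c d); first [exact Hq|lra].
Qed.

Lemma circ_split_y p q a b c m d :
  cont_rect p a b c d -> cont_rect q a b c d -> c <= m -> m <= d -> a <= b ->
  circ p q a b c d = circ p q a b c m + circ p q a b m d.
Proof.
  intros Hp Hq ? ? ?.
  pose proof (circ_split_x (tr q) (tr p) c m d a b (cont_rect_tr _ _ _ _ _ Hq)
    (cont_rect_tr _ _ _ _ _ Hp)) as E. rewrite !circ_tr in E. lra.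
Qed.

Lemma circ_degenerate_x p q a c d : circ p q a a c d = 0.
Proof.
  unfold circ. rewrite RInt_point.
  rewrite (RInt_ext (V := R_CompleteNormedModule) _ (fun _ => 0)).
  - rewrite RInt_const. change ((d - c) * 0 - 0 = 0). ring.
  - intros. apply Rminus_diag.
Qed.

(** [A] and [A'] are reference values for the increments between opposite sides. The form with
    integrability serves the Cauchy kernel, which is singular at the centre. *)
Lemma circ_bound_ex p q a b c d A B A' B' :
  a <= b -> c <= d ->
  ex_RInt (fun y => p b y - p a y) c d -> ex_RInt (fun x => q x d - q x c) a b ->
  (forall y, c <= y <= d -> Rabs (p b y - p a y - A) <= B) ->
  (forall x, a <= x <= b -> Rabs (q x d - q x c - A') <= B') ->
  Rabs (circ p q a b c d - (A * (d - c) - A' * (b - a))) <= B * (d - c) + B' * (b - a).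
Proof.
  intros Hab Hcd E1 E2 H1 H2. unfold circ.
  assert (K : forall g s t A B, s <= t -> ex_RInt g s t ->
     (forall x, s <= x <= t -> Rabs (g x - A) <= B) -> Rabs (RInt g s t - A * (t - s)) <= B * (t - s)).
  { clear. intros g s t A B Hst E H.
    replace (RInt g s t - A * (t - s)) with (RInt (fun x => g x - A) s t).
    - rewrite (Rmult_comm B). apply abs_RInt_le_const; auto.
      apply (ex_RInt_minus (V := R_NormedModule)); auto. apply ex_RInt_const.
    - rewrite (RInt_minus (V := R_CompleteNormedModule) g (fun _ => A)); auto.
      + rewrite RInt_const. change (RInt g s t - (t - s) * A = RInt g s t - A * (t - s)). ring.
      + apply ex_RInt_const. }
  pose proof (K _ _ _ A B Hcd E1 H1). pose proof (K _ _ _ A' B' Hab E2 H2).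
  apply Rabs_le_between in H, H0. apply Rabs_le_between. lra.
Qed.

Lemma circ_bound p q a b c d A B :
  cont_rect p a b c d -> cont_rect q a b c d -> a <= b -> c <= d ->
  (forall y, c <= y <= d -> Rabs (p b y - p a y - A) <= B) -> forall A' B',
  (forall x, a <= x <= b -> Rabs (q x d - q x c - A') <= B') ->
  Rabs (circ p q a b c d - (A * (d - c) - A' * (b - a))) <= B * (d - c) + B' * (b - a).
Proof.
  intros Hp Hq Hab Hcd H1 A' B' H2. apply circ_bound_ex; auto;
    apply (ex_RInt_minus (V := R_NormedModule)).
  1-2: apply (ex_RInt_col p a b c d); first [exact Hp|lra].
  all: apply (ex_RInt_row q a b c d); first [exact Hq|lra].
Qed.

(* Bisection: a local area bound for an additive rectangle function is a global one. *)
Lemma circ_area_of_local p q eps a b c d :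
  cont_rect p a b c d -> cont_rect q a b c d -> a <= b -> c <= d ->
  (forall x y, a <= x <= b -> c <= y <= d -> exists r, 0 < r /\
     forall a' b' c' d', a <= a' -> a' <= b' -> b' <= b -> c <= c' -> c' <= d' -> d' <= d ->
       x - r < a' -> b' < x + r -> y - r < c' -> d' < y + r ->
       Rabs (circ p q a' b' c' d') <= eps * ((b' - a') * (d' - c'))) ->
  Rabs (circ p q a b c d) <= eps * ((b - a) * (d - c)).
Proof.
  intros Hp Hq Hab Hcd H.
  (* The factor 2 leaves room for a whole rectangle with sides below [e <= r] whose corner is within
     [r] of the centre. *)
  destruct (lebesgue_number a b c d (fun x y r => forall a' b' c' d',
     a <= a' -> a' <= b' -> b' <= b -> c <= c' -> c' <= d' -> d' <= d ->
       x - 2 * r < a' -> b' < x + 2 * r -> y - 2 * r < c' -> d' < y + 2 * r ->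
       Rabs (circ p q a' b' c' d') <= eps * ((b' - a') * (d' - c')))) as [e [He HL]].
  { intros x y hx hy. destruct (H x y hx hy) as [r [Hr HH]]. exists (r / 2). split; [lra|].
    intros. apply HH; lra. }
  assert (Hn : forall n a' b' c' d', a <= a' -> a' <= b' -> b' <= b -> c <= c' -> c' <= d' -> d' <= d ->
     b' - a' < 2 ^ n * e -> d' - c' < 2 ^ n * e ->
     Rabs (circ p q a' b' c' d') <= eps * ((b' - a') * (d' - c'))).
  { induction n as [|n IH]; intros a' b' c' d' h1 h2 h3 h4 h5 h6 h7 h8.
    - simpl in h7, h8.
      destruct (HL a' c' ltac:(lra) ltac:(lra)) as (u & v & r & _ & _ & her & h9 & h10 & h11).
      apply Rabs_lt_between in h10, h11. apply h9; lra.
    - simpl in h7, h8. set (m := (a' + b') / 2). set (k := (c' + d') / 2).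
      assert (Cp := cont_rect_sub p a b c d a' b' c' d' Hp h1 h3 h4 h6).
      assert (Cq := cont_rect_sub q a b c d a' b' c' d' Hq h1 h3 h4 h6).
      rewrite (circ_split_x p q a' m b' c' d') by (auto; unfold m; lra).
      rewrite (circ_split_y p q a' m c' k d'), (circ_split_y p q m b' c' k d');
        try (unfold m, k; lra); try (eapply cont_rect_sub; eauto; unfold m, k; lra).
      pose proof (IH a' m c' k) as I1. pose proof (IH a' m k d') as I2.
      pose proof (IH m b' c' k) as I3. pose proof (IH m b' k d') as I4.
      unfold m, k in *.
      specialize (I1 ltac:(lra) ltac:(lra) ltac:(lra) ltac:(lra) ltac:(lra) ltac:(lra) ltac:(lra) ltac:(lra)).
      specialize (I2 ltac:(lra) ltac:(lra) ltac:(lra) ltac:(lra) ltac:(lra) ltac:(lra) ltac:(lra) ltac:(lra)).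
      specialize (I3 ltac:(lra) ltac:(lra) ltac:(lra) ltac:(lra) ltac:(lra) ltac:(lra) ltac:(lra) ltac:(lra)).
      specialize (I4 ltac:(lra) ltac:(lra) ltac:(lra) ltac:(lra) ltac:(lra) ltac:(lra) ltac:(lra) ltac:(lra)).
      apply Rabs_le_between in I1, I2, I3, I4. apply Rabs_le_between. nra. }
  destruct (Pow_x_infinity 2 ltac:(rewrite Rabs_pos_eq; lra) ((b - a + d - c + 1) / e)) as [n Hn'].
  specialize (Hn' n (Nat.le_refl n)). rewrite Rabs_pos_eq in Hn' by (apply pow_le; lra).
  assert (b - a + d - c + 1 <= 2 ^ n * e).
  { replace (b - a + d - c + 1) with ((b - a + d - c + 1) / e * e) by (field; lra).
    apply Rmult_le_compat_r; lra. }
  apply (Hn n); lra.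
Qed.

(** The vertical sides nearly cancel by uniform continuity of [p], and the horizontal ones are
    short. Hence the circulation depends continuously on the position of a vertical side. *)
Lemma circ_thin p q a b c d m k :
  cont_rect p a b c d -> cont_rect q a b c d -> a <= m <= b -> c <= d -> 0 < k ->
  exists r, 0 < r /\ forall s t, a <= s -> s <= t -> t <= b -> m - r < s -> t < m + r ->
    Rabs (circ p q s t c d) <= k.
Proof.
  intros Hp Hq Hm Hcd Hk.
  set (k1 := k / (2 * (d - c + 1))).
  assert (Hk1 : 0 < k1) by (apply Rdiv_lt_0_compat; lra).
  destruct (uniform_continuity_2d p a b c d Hp (mkposreal k1 Hk1)) as [r1 H1]. simpl in H1.
  destruct (Hq m d Hm ltac:(lra) (mkposreal 1 Rlt_0_1)) as [r2 H2].
  destruct (Hq m c Hm ltac:(lra) (mkposreal 1 Rlt_0_1)) as [r3 H3]. simpl in H2, H3.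
  set (A := q m d - q m c).
  pose proof (Rabs_pos A).
  set (r4 := k / (4 * (Rabs A + 2))).
  assert (Hr4 : 0 < r4) by (apply Rdiv_lt_0_compat; lra).
  destruct r1 as [r1 P1], r2 as [r2 P2], r3 as [r3 P3]. simpl in *.
  set (r := Rmin (Rmin (r1 / 2) r2) (Rmin r3 r4)).
  assert (r <= r1 / 2 /\ r <= r2 /\ r <= r3 /\ r <= r4) as (R1 & R2 & R3 & R4).
  { unfold r. pose proof (Rmin_l (Rmin (r1 / 2) r2) (Rmin r3 r4)).
    pose proof (Rmin_r (Rmin (r1 / 2) r2) (Rmin r3 r4)).
    pose proof (Rmin_l (r1 / 2) r2). pose proof (Rmin_r (r1 / 2) r2).
    pose proof (Rmin_l r3 r4). pose proof (Rmin_r r3 r4). lra. }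
  exists r. split.
  { unfold r. repeat apply Rmin_pos; lra. }
  intros s t h1 h2 h3 h4 h5.
  assert (B := circ_bound p q s t c d 0 k1
    (cont_rect_sub _ _ _ _ _ s t c d Hp h1 h3 (Rle_refl _) (Rle_refl _))
    (cont_rect_sub _ _ _ _ _ s t c d Hq h1 h3 (Rle_refl _) (Rle_refl _)) h2 Hcd).
  assert (B' := B ltac:(intros y Hy; rewrite Rminus_0_r; left; apply H1; try lra;
    [apply Rabs_lt_between; lra | rewrite Rminus_diag, Rabs_R0; lra]) A 2).
  specialize (B' ltac:(intros x Hx; unfold A;
    pose proof (H2 x d ltac:(apply Rabs_lt_between; lra) ltac:(rewrite Rminus_diag, Rabs_R0; lra)) as g1;
    pose proof (H3 x c ltac:(apply Rabs_lt_between; lra) ltac:(rewrite Rminus_diag, Rabs_R0; lra)) as g2;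
    apply Rabs_lt_between in g1, g2; apply Rabs_le_between; lra)).
  assert (E1 : k1 * (d - c) <= k / 2).
  { replace (k / 2) with (k1 * (d - c + 1)) by (unfold k1; field; lra). nra. }
  assert (E2 : (Rabs A + 2) * (t - s) <= k / 2).
  { replace (k / 2) with ((Rabs A + 2) * (2 * r4)) by (unfold r4; field; lra).
    apply Rmult_le_compat_l; lra. }
  pose proof (Rle_abs A). pose proof (Rle_abs (- A)). rewrite Rabs_Ropp in *.
  apply Rabs_le_between in B'. apply Rabs_le_between. nra.
Qed.

(** Lets an area bound reach a rectangle that meets the exceptional set only along its right
    side. *)
Lemma circ_limit_right p q eps a b c d :
  cont_rect p a b c d -> cont_rect q a b c d -> 0 <= eps -> a <= b -> c <= d ->
  (forall s, a <= s < b -> Rabs (circ p q a s c d) <= eps * ((s - a) * (d - c))) ->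
  Rabs (circ p q a b c d) <= eps * ((b - a) * (d - c)).
Proof.
  intros Hp Hq He Hab Hcd H.
  destruct (Req_dec a b) as [<-|Hn].
  { rewrite circ_degenerate_x, Rabs_R0, Rminus_diag. lra. }
  apply le_epsilon. intros k Hk.
  destruct (circ_thin p q a b c d b k Hp Hq ltac:(lra) Hcd Hk) as [r [Hr HH]].
  set (s := Rmax a (b - r / 2)).
  assert (a <= s < b /\ b - r < s).
  { unfold s. pose proof (Rmax_l a (b - r / 2)). pose proof (Rmax_r a (b - r / 2)).
    split; [split; [auto|apply Rmax_lub_lt]|]; lra. }
  rewrite (circ_split_x p q a s b c d) by (auto; lra).
  specialize (HH s b ltac:(lra) ltac:(lra) ltac:(lra) ltac:(lra) ltac:(lra)).
  specialize (H s ltac:(lra)).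
  eapply Rle_trans; [apply Rabs_triang|].
  assert (eps * ((s - a) * (d - c)) <= eps * ((b - a) * (d - c))); [|lra].
  apply Rmult_le_compat_l; auto. apply Rmult_le_compat_r; lra.
Qed.

Lemma circ_limit_left p q eps a b c d :
  cont_rect p a b c d -> cont_rect q a b c d -> 0 <= eps -> a <= b -> c <= d ->
  (forall s, a < s <= b -> Rabs (circ p q s b c d) <= eps * ((b - s) * (d - c))) ->
  Rabs (circ p q a b c d) <= eps * ((b - a) * (d - c)).
Proof.
  intros Hp Hq He Hab Hcd H.
  destruct (Req_dec a b) as [<-|Hn].
  { rewrite circ_degenerate_x, Rabs_R0, Rminus_diag. lra. }
  apply le_epsilon. intros k Hk.
  destruct (circ_thin p q a b c d a k Hp Hq ltac:(lra) Hcd Hk) as [r [Hr HH]].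
  set (s := Rmin b (a + r / 2)).
  assert (a < s <= b /\ s < a + r).
  { unfold s. pose proof (Rmin_l b (a + r / 2)). pose proof (Rmin_r b (a + r / 2)).
    split; [split; [apply Rmin_glb_lt|auto]|]; lra. }
  rewrite (circ_split_x p q a s b c d) by (auto; lra).
  specialize (HH a s ltac:(lra) ltac:(lra) ltac:(lra) ltac:(lra) ltac:(lra)).
  specialize (H s ltac:(lra)).
  eapply Rle_trans; [apply Rabs_triang|].
  assert (eps * ((b - s) * (d - c)) <= eps * ((b - a) * (d - c))); [|lra].
  apply Rmult_le_compat_l; auto. apply Rmult_le_compat_r; lra.
Qed.

(** * Circulation near a portion of the exceptional set *)

Definition closed2 (E : R -> R -> Prop) : Prop :=
  forall x y, ~ E x y -> exists r, 0 < r /\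
    forall x' y', Rabs (x' - x) < r -> Rabs (y' - y) < r -> ~ E x' y'.

Definition touches (E : R -> R -> Prop) (a b c d : R) : Prop :=
  ((exists y, c <= y <= d /\ E a y) /\ (exists y, c <= y <= d /\ E b y)) /\
  ((exists x, a <= x <= b /\ E x c) /\ (exists x, a <= x <= b /\ E x d)).

Lemma closed2_rect E a b c d :
  closed2 E -> closed2 (fun x y => E x y /\ a <= x <= b /\ c <= y <= d).
Proof.
  intros HE x y N. destruct (classic (E x y)) as [e|e].
  - assert (exists r, 0 < r /\ (x + r <= a \/ b <= x - r \/ y + r <= c \/ d <= y - r)) as [r [Hr D]].
    { destruct (Rlt_or_le x a). { exists (a - x); split; [|left]; lra. }
      destruct (Rlt_or_le b x). { exists (x - b); split; [|right; left]; lra. }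
      destruct (Rlt_or_le y c). { exists (c - y); split; [|right; right; left]; lra. }
      destruct (Rlt_or_le d y). { exists (y - d); split; [|right; right; right]; lra. }
      exfalso; apply N; repeat split; auto. }
    exists r; split; auto. intros x' y' h1 h2 [_ h3].
    apply Rabs_lt_between in h1, h2. lra.
  - destruct (HE x y e) as [r [Hr H]]. exists r; split; auto.
    intros x' y' h1 h2 [h3 _]. now apply (H x' y').
Qed.

(** The bounding box of the compact part of [E] in the rectangle: points of [E] maximizing [- x],
    [x], [- y] and [y] lie on its four sides. *)
Lemma touching_hull E a b c d :
  closed2 E ->
  (forall x y, a <= x <= b -> c <= y <= d -> ~ E x y) \/
  exists a' b' c' d', a <= a' /\ a' <= b' /\ b' <= b /\ c <= c' /\ c' <= d' /\ d' <= d /\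
    touches E a' b' c' d' /\
    forall x y, a <= x <= b -> c <= y <= d -> E x y -> a' <= x <= b' /\ c' <= y <= d'.
Proof.
  intros HE.
  destruct (classic (exists x y, E x y /\ a <= x <= b /\ c <= y <= d)) as [N|N];
    [|left; intros x y hx hy e; apply N; eauto].
  right.
  assert (M : forall F : R -> R -> R, (forall x y e, 0 < e -> exists r, 0 < r /\
     forall x' y', Rabs (x' - x) < r -> Rabs (y' - y) < r -> F x' y' < F x y + e) ->
     exists x y, (E x y /\ a <= x <= b /\ c <= y <= d) /\
       forall x' y', E x' y' /\ a <= x' <= b /\ c <= y' <= d -> F x' y' <= F x y).
  { intros F HF. apply (closed_max a b c d); auto.
    - tauto.
    - apply closed2_rect; auto.
    - intros x y _ e He. destruct (HF x y e He) as [r [Hr H]]. exists r; split; auto. }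
  destruct (M (fun x y => - x)) as (x1 & y1 & k1 & m1).
  { intros x y e He. exists e; split; auto. intros x' y' h1 h2.
    apply Rabs_lt_between in h1; lra. }
  destruct (M (fun x y => x)) as (x2 & y2 & k2 & m2).
  { intros x y e He. exists e; split; auto. intros x' y' h1 h2.
    apply Rabs_lt_between in h1; lra. }
  destruct (M (fun x y => - y)) as (x3 & y3 & k3 & m3).
  { intros x y e He. exists e; split; auto. intros x' y' h1 h2.
    apply Rabs_lt_between in h2; lra. }
  destruct (M (fun x y => y)) as (x4 & y4 & k4 & m4).
  { intros x y e He. exists e; split; auto. intros x' y' h1 h2.
    apply Rabs_lt_between in h2; lra. }
  assert (H : forall x y, E x y /\ a <= x <= b /\ c <= y <= d -> x1 <= x <= x2 /\ y3 <= y <= y4).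
  { intros x y k. specialize (m1 x y k). specialize (m2 x y k).
    specialize (m3 x y k). specialize (m4 x y k). simpl in *. lra. }
  exists x1, x2, y3, y4.
  pose proof (H _ _ k1). pose proof (H _ _ k2). pose proof (H _ _ k3). pose proof (H _ _ k4).
  repeat split; try lra.
  - exists y1; split; [lra|tauto].
  - exists y2; split; [lra|tauto].
  - exists x3; split; [lra|tauto].
  - exists x4; split; [lra|tauto].
  - destruct (H x y); auto; lra.
  - destruct (H x y); auto; lra.
  - destruct (H x y); auto; lra.
  - destruct (H x y); auto; lra.
Qed.

(** [A], [B], [C], [D] approximate [p_x], [p_y], [q_x], [q_y] uniformly over the rectangle, but only
    for increments issuing from points of [E]. [portion_AD] is the approximate form of [p_x = q_y].
    The error [2 * e] allows one [e] for changing the step and one for moving the base point. *)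
Record portion (p q : R -> R -> R) (E : R -> R -> Prop) (A B C D e eps X0 X1 Y0 Y1 : R) : Prop := {
  portion_p : cont_rect p X0 X1 Y0 Y1;
  portion_q : cont_rect q X0 X1 Y0 Y1;
  portion_closed : closed2 E;
  portion_e : 0 <= e;
  portion_AD : Rabs (A - D) <= e;
  portion_px : forall x x' y, X0 <= x <= X1 -> X0 <= x' <= X1 -> Y0 <= y <= Y1 -> E x y ->
    Rabs (p x' y - p x y - A * (x' - x)) <= 2 * e * Rabs (x' - x);
  portion_py : forall x y y', X0 <= x <= X1 -> Y0 <= y <= Y1 -> Y0 <= y' <= Y1 -> E x y ->
    Rabs (p x y' - p x y - B * (y' - y)) <= 2 * e * Rabs (y' - y);
  portion_qx : forall x x' y, X0 <= x <= X1 -> X0 <= x' <= X1 -> Y0 <= y <= Y1 -> E x y ->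
    Rabs (q x' y - q x y - C * (x' - x)) <= 2 * e * Rabs (x' - x);
  portion_qy : forall x y y', X0 <= x <= X1 -> Y0 <= y <= Y1 -> Y0 <= y' <= Y1 -> E x y ->
    Rabs (q x y' - q x y - D * (y' - y)) <= 2 * e * Rabs (y' - y);
  portion_free : forall a b c d, X0 <= a -> a <= b -> b <= X1 -> Y0 <= c -> c <= d -> d <= Y1 ->
    (forall x y, a <= x <= b -> c <= y <= d -> ~ E x y) ->
    Rabs (circ p q a b c d) <= eps * ((b - a) * (d - c)) }.

Arguments portion_p {p q E A B C D e eps X0 X1 Y0 Y1} _.
Arguments portion_q {p q E A B C D e eps X0 X1 Y0 Y1} _.
Arguments portion_closed {p q E A B C D e eps X0 X1 Y0 Y1} _.
Arguments portion_e {p q E A B C D e eps X0 X1 Y0 Y1} _.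
Arguments portion_AD {p q E A B C D e eps X0 X1 Y0 Y1} _.
Arguments portion_px {p q E A B C D e eps X0 X1 Y0 Y1} _.
Arguments portion_py {p q E A B C D e eps X0 X1 Y0 Y1} _.
Arguments portion_qx {p q E A B C D e eps X0 X1 Y0 Y1} _.
Arguments portion_qy {p q E A B C D e eps X0 X1 Y0 Y1} _.
Arguments portion_free {p q E A B C D e eps X0 X1 Y0 Y1} _.

Lemma portion_tr {p q E A B C D e eps X0 X1 Y0 Y1} :
  portion p q E A B C D e eps X0 X1 Y0 Y1 ->
  portion (tr q) (tr p) (tr E) D C B A e eps Y0 Y1 X0 X1.
Proof.
  intros []. constructor; auto.
  - now apply cont_rect_tr.
  - now apply cont_rect_tr.
  - intros x y N. destruct (portion_closed0 y x N) as [r [Hr H]]. exists r; split; auto.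
    intros x' y' ? ?. now apply H.
  - now rewrite Rabs_minus_sym.
  - intros. unfold tr in *. auto.
  - intros. unfold tr in *. auto.
  - intros. unfold tr in *. auto.
  - intros. unfold tr in *. auto.
  - intros a b c d. intros. rewrite circ_tr, Rabs_Ropp, (Rmult_comm (b - a)).
    apply portion_free0; auto. intros x y ? ?. now apply (H5 y x).
Qed.

Lemma touches_tr E a b c d : touches E a b c d -> touches (tr E) c d a b.
Proof. unfold touches, tr. tauto. Qed.

(** The endpoints [(a, y)] and [(b, y)] need not lie in [E], so they are joined through points of
    [E] on the left, bottom and right sides. Six axis-parallel increments are used, each with error
    at most [2 * e] times the half-perimeter, and the terms in [B] cancel. *)
Lemma portion_increment {p q E A B C D e eps X0 X1 Y0 Y1} a b c d y :
  portion p q E A B C D e eps X0 X1 Y0 Y1 ->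
  X0 <= a -> a <= b -> b <= X1 -> Y0 <= c -> c <= d -> d <= Y1 -> touches E a b c d ->
  c <= y <= d ->
  Rabs (p b y - p a y - A * (b - a)) <= 12 * e * (b - a + d - c).
Proof.
  intros P h1 h2 h3 h4 h5 h6 [[(ya & Ha & Ea) (yb & Hb & Eb)] [(xc & Hc & Ec) _]] Hy.
  pose proof (portion_e P) as He.
  assert (T : forall z z' k l, Rabs (z - k) <= 2 * e * Rabs z' -> Rabs z' <= l ->
     k - 2 * e * l <= z <= k + 2 * e * l).
  { intros z z' k l H1 H2. apply Rabs_le_between in H1.
    assert (2 * e * Rabs z' <= 2 * e * l) by (apply Rmult_le_compat_l; lra). lra. }
  assert (S : forall u v l, - l <= u - v <= l -> Rabs (u - v) <= l)
    by (intros; now apply Rabs_le_between).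
  set (L := b - a + d - c).
  pose proof (T _ _ _ L (portion_py P a ya y ltac:(lra) ltac:(lra) ltac:(lra) Ea)
    ltac:(apply S; unfold L; lra)).
  pose proof (T _ _ _ L (portion_py P a ya c ltac:(lra) ltac:(lra) ltac:(lra) Ea)
    ltac:(apply S; unfold L; lra)).
  pose proof (T _ _ _ L (portion_py P b yb y ltac:(lra) ltac:(lra) ltac:(lra) Eb)
    ltac:(apply S; unfold L; lra)).
  pose proof (T _ _ _ L (portion_py P b yb c ltac:(lra) ltac:(lra) ltac:(lra) Eb)
    ltac:(apply S; unfold L; lra)).
  pose proof (T _ _ _ L (portion_px P xc a c ltac:(lra) ltac:(lra) ltac:(lra) Ec)
    ltac:(apply S; unfold L; lra)).
  pose proof (T _ _ _ L (portion_px P xc b c ltac:(lra) ltac:(lra) ltac:(lra) Ec)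
    ltac:(apply S; unfold L; lra)).
  apply Rabs_le_between. fold L. lra.
Qed.

(** The linear parts leave [(A - D)] times the area, at most [e] times the squared half-perimeter;
    with 12 from the increments this makes 13. *)
Lemma portion_touches {p q E A B C D e eps X0 X1 Y0 Y1} a b c d :
  portion p q E A B C D e eps X0 X1 Y0 Y1 ->
  X0 <= a -> a <= b -> b <= X1 -> Y0 <= c -> c <= d -> d <= Y1 -> touches E a b c d ->
  Rabs (circ p q a b c d) <= 13 * e * (b - a + d - c) ^ 2.
Proof.
  intros P h1 h2 h3 h4 h5 h6 T.
  pose proof (circ_bound p q a b c d (A * (b - a)) (12 * e * (b - a + d - c))
    (cont_rect_sub _ _ _ _ _ a b c d (portion_p P) h1 h3 h4 h6)
    (cont_rect_sub _ _ _ _ _ a b c d (portion_q P) h1 h3 h4 h6) h2 h5) as H.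
  specialize (H ltac:(intros y Hy; eapply portion_increment; eauto) (D * (d - c)) (12 * e * (b - a + d - c))).
  assert (Q : forall x, a <= x <= b -> Rabs (q x d - q x c - D * (d - c)) <= 12 * e * (b - a + d - c)).
  { intros x Hx. replace (b - a + d - c) with (d - c + b - a) by ring.
    exact (portion_increment c d a b x (portion_tr P)
      h4 h5 h6 h1 h2 h3 (touches_tr _ _ _ _ _ T) Hx). }
  specialize (H Q). pose proof (portion_AD P) as HA.
  pose proof (portion_e P) as He.
  assert (G : Rabs ((A - D) * ((b - a) * (d - c))) <= e * (b - a + d - c) ^ 2).
  { rewrite Rabs_mult. apply Rmult_le_compat; auto using Rabs_pos.
    rewrite Rabs_pos_eq; nra. }
  apply Rabs_le_between in G, H. apply Rabs_le_between. nra.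
Qed.

(** [E] meets the rectangle at most in one vertical side, and the rectangles stopping short of that
    side are free of [E]. *)
Lemma portion_strip {p q E A B C D e eps X0 X1 Y0 Y1} a b c d :
  portion p q E A B C D e eps X0 X1 Y0 Y1 -> 0 <= eps ->
  X0 <= a -> a <= b -> b <= X1 -> Y0 <= c -> c <= d -> d <= Y1 ->
  (forall x y, a <= x <= b -> c <= y <= d -> E x y -> b <= x) \/
  (forall x y, a <= x <= b -> c <= y <= d -> E x y -> x <= a) ->
  Rabs (circ p q a b c d) <= eps * ((b - a) * (d - c)).
Proof.
  intros P He h1 h2 h3 h4 h5 h6 [H|H]; [apply circ_limit_right|apply circ_limit_left]; auto;
    try (eapply cont_rect_sub; [first [solve [eapply portion_p; eauto] | eapply portion_q; eauto]|..]; lra).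
  - intros s Hs. apply (portion_free P); try lra.
    intros x y Hx Hy k. specialize (H x y ltac:(lra) Hy k). lra.
  - intros s Hs. apply (portion_free P); try lra.
    intros x y Hx Hy k. specialize (H x y ltac:(lra) Hy k). lra.
Qed.

Lemma portion_strip_tr {p q E A B C D e eps X0 X1 Y0 Y1} a b c d :
  portion p q E A B C D e eps X0 X1 Y0 Y1 -> 0 <= eps ->
  X0 <= a -> a <= b -> b <= X1 -> Y0 <= c -> c <= d -> d <= Y1 ->
  (forall x y, a <= x <= b -> c <= y <= d -> E x y -> d <= y) \/
  (forall x y, a <= x <= b -> c <= y <= d -> E x y -> y <= c) ->
  Rabs (circ p q a b c d) <= eps * ((b - a) * (d - c)).
Proof.
  intros P He h1 h2 h3 h4 h5 h6 H.
  rewrite <- Rabs_Ropp, <- circ_tr, (Rmult_comm (b - a)).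
  apply (portion_strip _ _ _ _ (portion_tr P)); auto.
  unfold tr. destruct H as [H|H]; [left|right]; intros; eapply H; eauto.
Qed.

(** Around the hull remain two strips of full height and two between them; each can meet [E] only in
    the side it shares with the hull. *)
Lemma portion_hull {p q E A B C D e eps X0 X1 Y0 Y1} a b c d a' b' c' d' :
  portion p q E A B C D e eps X0 X1 Y0 Y1 -> 0 <= eps ->
  X0 <= a -> b <= X1 -> Y0 <= c -> d <= Y1 ->
  a <= a' -> a' <= b' -> b' <= b -> c <= c' -> c' <= d' -> d' <= d ->
  (forall x y, a <= x <= b -> c <= y <= d -> E x y -> a' <= x <= b' /\ c' <= y <= d') ->
  Rabs (circ p q a b c d) <=
    Rabs (circ p q a' b' c' d') + eps * ((b - a) * (d - c) - (b' - a') * (d' - c')).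
Proof.
  intros P He h1 h2 h3 h4 h5 h6 h7 h8 h9 h10 H.
  assert (Cp : forall s t u v, X0 <= s -> t <= X1 -> Y0 <= u -> v <= Y1 -> cont_rect p s t u v).
  { intros. eapply cont_rect_sub; [eapply portion_p; eauto|..]; auto. }
  assert (Cq : forall s t u v, X0 <= s -> t <= X1 -> Y0 <= u -> v <= Y1 -> cont_rect q s t u v).
  { intros. eapply cont_rect_sub; [eapply portion_q; eauto|..]; auto. }
  rewrite (circ_split_x p q a a' b c d) by (first [apply Cp | apply Cq | idtac]; lra).
  rewrite (circ_split_x p q a' b' b c d) by (first [apply Cp | apply Cq | idtac]; lra).
  rewrite (circ_split_y p q a' b' c c' d) by (first [apply Cp | apply Cq | idtac]; lra).
  rewrite (circ_split_y p q a' b' c' d' d) by (first [apply Cp | apply Cq | idtac]; lra).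
  pose proof (portion_strip a a' c d P He ltac:(lra) ltac:(lra)
    ltac:(lra) ltac:(lra) ltac:(lra) ltac:(lra)
    ltac:(left; intros x y Hx Hy k; destruct (H x y ltac:(lra) ltac:(lra) k); lra)) as I1.
  pose proof (portion_strip b' b c d P He ltac:(lra) ltac:(lra)
    ltac:(lra) ltac:(lra) ltac:(lra) ltac:(lra)
    ltac:(right; intros x y Hx Hy k; destruct (H x y ltac:(lra) ltac:(lra) k); lra)) as I2.
  pose proof (portion_strip_tr a' b' c c' P He ltac:(lra) ltac:(lra)
    ltac:(lra) ltac:(lra) ltac:(lra) ltac:(lra)
    ltac:(left; intros x y Hx Hy k; destruct (H x y ltac:(lra) ltac:(lra) k); lra)) as I3.
  pose proof (portion_strip_tr a' b' d' d P He ltac:(lra) ltac:(lra)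
    ltac:(lra) ltac:(lra) ltac:(lra) ltac:(lra)
    ltac:(right; intros x y Hx Hy k; destruct (H x y ltac:(lra) ltac:(lra) k); lra)) as I4.
  pose proof (Rle_abs (circ p q a' b' c' d')). pose proof (Rle_abs (- circ p q a' b' c' d')).
  rewrite Rabs_Ropp in *.
  apply Rabs_le_between in I1, I2, I3, I4. apply Rabs_le_between.
  replace (eps * ((b - a) * (d - c) - (b' - a') * (d' - c'))) with
    (eps * ((a' - a) * (d - c)) + eps * ((b - b') * (d - c)) + eps * ((b' - a') * (c' - c))
      + eps * ((b' - a') * (d - d'))) by ring.
  lra.
Qed.

(** The defect is measured by the squared half-perimeter, which is much larger than the area of a
    long rectangle; this disproportion is what the cutting exploits. *)
Definition slack p q eps K X0 X1 Y0 Y1 : Prop :=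
  forall a b c d, X0 <= a -> a <= b -> b <= X1 -> Y0 <= c -> c <= d -> d <= Y1 ->
    Rabs (circ p q a b c d) <= eps * ((b - a) * (d - c)) + K * (b - a + d - c) ^ 2.

Lemma slack_tr p q eps K X0 X1 Y0 Y1 :
  slack p q eps K X0 X1 Y0 Y1 -> slack (tr q) (tr p) eps K Y0 Y1 X0 X1.
Proof.
  intros H a b c d ? ? ? ? ? ?. rewrite circ_tr, Rabs_Ropp, (Rmult_comm (b - a)).
  replace (b - a + d - c) with (d - c + b - a) by ring. apply H; auto.
Qed.

(** Columns are peeled off from the right, each no wider than tall and so of half-perimeter at most
    [2 * (d - c)]. *)
Lemma slack_columns p q eps K X0 X1 Y0 Y1 a c d n :
  cont_rect p X0 X1 Y0 Y1 -> cont_rect q X0 X1 Y0 Y1 -> 0 <= K ->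
  slack p q eps K X0 X1 Y0 Y1 -> X0 <= a -> Y0 <= c -> c <= d -> d <= Y1 ->
  forall b, a <= b -> b <= X1 -> b - a <= INR n * (d - c) ->
  Rabs (circ p q a b c d) <= eps * ((b - a) * (d - c)) + INR n * (K * (2 * (d - c)) ^ 2).
Proof.
  intros Cp Cq HK H h1 h2 h3 h4. induction n as [|n IH]; intros b h5 h6 h7.
  - simpl in h7. replace b with a by lra. rewrite circ_degenerate_x, Rabs_R0. simpl. lra.
  - rewrite S_INR in *. set (m := Rmax a (b - (d - c))).
    assert (Hm : a <= m <= b /\ b - m <= d - c /\ m - a <= INR n * (d - c)).
    { unfold m. pose proof (pos_INR n). apply Rmax_case_strong; intros; nra. }
    rewrite (circ_split_x p q a m b c d);
      try (eapply cont_rect_sub; [first [exact Cp | exact Cq]|..]); try lra.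
    specialize (IH m ltac:(lra) ltac:(lra) ltac:(lra)).
    specialize (H m b c d ltac:(lra) ltac:(lra) ltac:(lra) ltac:(lra) ltac:(lra) ltac:(lra)).
    assert (K * (b - m + d - c) ^ 2 <= K * (2 * (d - c)) ^ 2).
    { apply Rmult_le_compat_l; auto. apply pow_incr. lra. }
    eapply Rle_trans; [apply Rabs_triang|]. nra.
Qed.

(** If [w <= 10 * h] then [(w + h) ^ 2 <= 40 * (w * h)], and [13 * 40 = 520] lets the area term
    absorb the whole error. Otherwise at most [w / h + 1] columns cost [4 * h ^ 2] each, in total at
    most [4 * h * (w + h)], which is below [(w + h) ^ 2 / 2]. *)
Lemma portion_wide {p q E A B C D e eps X0 X1 Y0 Y1} K a b c d :
  portion p q E A B C D e eps X0 X1 Y0 Y1 -> 520 * e <= eps -> 0 <= K ->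
  slack p q eps K X0 X1 Y0 Y1 ->
  X0 <= a -> a <= b -> b <= X1 -> Y0 <= c -> c <= d -> d <= Y1 -> touches E a b c d ->
  d - c <= b - a ->
  Rabs (circ p q a b c d) <= eps * ((b - a) * (d - c)) + K / 2 * (b - a + d - c) ^ 2.
Proof.
  intros P He HK H h1 h2 h3 h4 h5 h6 T Hw.
  pose proof (portion_e P) as He0.
  set (w := b - a) in *. set (h := d - c) in *.
  replace (w + d - c) with (w + h) by (unfold h; ring).
  assert (0 <= h) by (unfold h; lra).
  destruct (Rle_or_lt w (10 * h)) as [Ha|Ha].
  - pose proof (portion_touches a b c d P h1 h2 h3 h4 h5 h6 T) as I.
    fold w in I. replace (w + d - c) with (w + h) in I by (unfold h; ring).
    assert ((w + h) ^ 2 <= 40 * (w * h)) by nra.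
    assert (13 * e * (w + h) ^ 2 <= 13 * e * (40 * (w * h))) by (apply Rmult_le_compat_l; lra).
    assert (520 * e * (w * h) <= eps * (w * h)) by (apply Rmult_le_compat_r; nra).
    assert (0 <= K / 2 * (w + h) ^ 2) by (apply Rmult_le_pos; [lra|apply pow2_ge_0]). lra.
  - destruct (Req_dec h 0) as [Z|Z].
    + replace d with c by (unfold h in Z; lra).
      rewrite <- (Ropp_involutive (circ p q a b c c)), <- circ_tr, circ_degenerate_x, Ropp_0, Rabs_R0.
      rewrite Z. assert (0 <= K / 2 * (w + 0) ^ 2) by (apply Rmult_le_pos; [lra|apply pow2_ge_0]). lra.
    + destruct (nfloor_ex (w / h)) as [n Hn]; [apply Rdiv_le_0_compat; lra|].
      assert (Hn1 : INR n * h <= w < (INR n + 1) * h).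
      { replace w with (w / h * h) by (field; auto). split.
        - apply Rmult_le_compat_r; lra.
        - apply Rmult_lt_compat_r; lra. }
      pose proof (slack_columns p q eps K X0 X1 Y0 Y1 a c d (S n)
        (portion_p P) (portion_q P) HK H
        h1 h4 h5 h6 b h2 h3) as I.
      rewrite S_INR in I. fold w h in I. specialize (I ltac:(lra)).
      assert ((INR n + 1) * (2 * h) ^ 2 <= 1 / 2 * (w + h) ^ 2) by nra.
      assert (K * ((INR n + 1) * (2 * h) ^ 2) <= K * (1 / 2 * (w + h) ^ 2))
        by (apply Rmult_le_compat_l; auto).
      lra.
Qed.

(** Passing to the hull comes before the estimate because the case of bounded eccentricity needs a
    point of [E] on every side. The half-perimeter does not grow. *)
Lemma portion_halve {p q E A B C D e eps X0 X1 Y0 Y1} K :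
  portion p q E A B C D e eps X0 X1 Y0 Y1 -> 520 * e <= eps -> 0 <= K ->
  slack p q eps K X0 X1 Y0 Y1 -> slack p q eps (K / 2) X0 X1 Y0 Y1.
Proof.
  intros P He HK H a b c d h1 h2 h3 h4 h5 h6.
  pose proof (portion_e P) as He0.
  assert (0 <= K / 2 * (b - a + d - c) ^ 2) by (apply Rmult_le_pos; [lra|apply pow2_ge_0]).
  destruct (touching_hull E a b c d (portion_closed P))
    as [N|(a' & b' & c' & d' & g1 & g2 & g3 & g4 & g5 & g6 & T & Hull)].
  - pose proof (portion_free P a b c d h1 h2 h3 h4 h5 h6 N). lra.
  - pose proof (portion_hull a b c d a' b' c' d' P
      ltac:(lra) h1 h3 h4 h6 g1 g2 g3 g4 g5 g6 Hull) as I.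
    assert (J : Rabs (circ p q a' b' c' d') <=
      eps * ((b' - a') * (d' - c')) + K / 2 * (b' - a' + d' - c') ^ 2).
    { destruct (Rle_or_lt (d' - c') (b' - a')).
      - eapply portion_wide; eauto; lra.
      - rewrite <- Rabs_Ropp, <- circ_tr, (Rmult_comm (b' - a')).
        replace (b' - a' + d' - c') with (d' - c' + b' - a') by ring.
        eapply portion_wide; [eapply portion_tr; eauto|auto|auto|apply slack_tr; eauto|..]; try lra.
        now apply touches_tr. }
    assert (K / 2 * (b' - a' + d' - c') ^ 2 <= K / 2 * (b - a + d - c) ^ 2).
    { apply Rmult_le_compat_l; [lra|]. apply pow_incr. lra. }
    lra.
Qed.

Lemma portion_area {p q E A B C D e eps X0 X1 Y0 Y1} a b c d :
  portion p q E A B C D e eps X0 X1 Y0 Y1 -> 520 * e <= eps ->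
  X0 <= a -> a <= b -> b <= X1 -> Y0 <= c -> c <= d -> d <= Y1 ->
  Rabs (circ p q a b c d) <= eps * ((b - a) * (d - c)).
Proof.
  intros P He h1 h2 h3 h4 h5 h6.
  pose proof (portion_e P) as He0.
  (* The starting defect comes from the touching estimate on the hull. *)
  assert (S0 : slack p q eps (13 * e) X0 X1 Y0 Y1).
  { clear a b c d h1 h2 h3 h4 h5 h6. intros a b c d h1 h2 h3 h4 h5 h6.
    destruct (touching_hull E a b c d (portion_closed P))
      as [N|(a' & b' & c' & d' & g1 & g2 & g3 & g4 & g5 & g6 & T & Hull)].
    - pose proof (portion_free P a b c d h1 h2 h3 h4 h5 h6 N).
      assert (0 <= 13 * e * (b - a + d - c) ^ 2) by (apply Rmult_le_pos; [lra|apply pow2_ge_0]). lra.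
    - pose proof (portion_hull a b c d a' b' c' d' P
        ltac:(lra) h1 h3 h4 h6 g1 g2 g3 g4 g5 g6 Hull) as I.
      pose proof (portion_touches a' b' c' d' P ltac:(lra) g2 ltac:(lra)
        ltac:(lra) g5 ltac:(lra) T).
      assert (13 * e * (b' - a' + d' - c') ^ 2 <= 13 * e * (b - a + d - c) ^ 2).
      { apply Rmult_le_compat_l; [lra|]. apply pow_incr. lra. }
      assert (0 <= eps * ((b' - a') * (d' - c'))).
      { apply Rmult_le_pos; [lra|]. apply Rmult_le_pos; lra. }
      lra. }
  assert (Sn : forall n, slack p q eps (13 * e * / 2 ^ n) X0 X1 Y0 Y1).
  { induction n as [|n IH].
    - simpl. now rewrite Rinv_1, Rmult_1_r.
    - replace (13 * e * / 2 ^ S n) with (13 * e * / 2 ^ n / 2).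
      2:{ simpl. field. apply pow_nonzero; lra. }
      eapply portion_halve; eauto. apply Rmult_le_pos; [lra|].
      left. apply Rinv_0_lt_compat, pow_lt; lra. }
  apply le_epsilon. intros k Hk.
  set (Z := 13 * e * (b - a + d - c) ^ 2).
  assert (0 <= Z) by (apply Rmult_le_pos; [lra|apply pow2_ge_0]).
  destruct (Pow_x_infinity 2 ltac:(rewrite Rabs_pos_eq; lra) (Z / k)) as [n Hn].
  specialize (Hn n (Nat.le_refl n)). rewrite Rabs_pos_eq in Hn by (apply pow_le; lra).
  specialize (Sn n a b c d h1 h2 h3 h4 h5 h6).
  assert (0 < 2 ^ n) by (apply pow_lt; lra).
  assert (Z <= 2 ^ n * k).
  { replace Z with (Z / k * k) by (field; lra). apply Rmult_le_compat_r; lra. }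
  assert (13 * e * / 2 ^ n * (b - a + d - c) ^ 2 <= k).
  { replace (13 * e * / 2 ^ n * (b - a + d - c) ^ 2) with (Z / 2 ^ n) by (unfold Z; field; lra).
    apply Rmult_le_reg_r with (2 ^ n); auto. unfold Rdiv. rewrite Rmult_assoc, Rinv_l; lra. }
  lra.
Qed.

(** * Baire category, and differentiability made uniform on a portion *)

(** Otherwise closed squares centred in [E] can be nested with the [n]-th choice avoiding [F n];
    their centres converge to a point of [E] in no [F n]. Covering is asked only on the first
    square, which contains all the others. *)
Lemma baire_portion (E : R -> R -> Prop) (F : nat -> R -> R -> Prop) (x0 y0 r0 : R) :
  closed2 E -> (forall n, closed2 (F n)) -> E x0 y0 -> 0 < r0 ->
  (forall x y, Rabs (x - x0) <= r0 -> Rabs (y - y0) <= r0 -> E x y -> exists n, F n x y) ->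
  exists n x1 y1 r1, 0 < r1 /\ E x1 y1 /\
    forall x y, Rabs (x - x1) < r1 -> Rabs (y - y1) < r1 -> E x y -> F n x y.
Proof.
  intros HE HF H0 Hr0 Hcov. apply NNPP. intros N.
  set (inner := fun n (z w : R * R * R) =>
    let '(x, y, r) := z in let '(x', y', r') := w in
    E x' y' /\ 0 < r' /\ r' <= r / 2 /\ Rabs (x' - x) <= r - r' /\ Rabs (y' - y) <= r - r' /\
    forall u v, Rabs (u - x') <= r' -> Rabs (v - y') <= r' -> ~ F n u v).
  (* The invariant is a premise under the existential, so that the choice function [next] is
     total. *)
  assert (step : forall n z, exists w,
     (let '(x, y, r) := z in E x y /\ 0 < r) -> inner n z w).
  { intros n [[x y] r]. destruct (classic (E x y /\ 0 < r)) as [[e Hr]|M];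
      [|exists (x, y, r); tauto].
    assert (exists x' y', Rabs (x' - x) < r /\ Rabs (y' - y) < r /\ E x' y' /\ ~ F n x' y')
      as (x' & y' & h1 & h2 & e' & f').
    { apply NNPP. intros M. apply N. exists n, x, y, r. repeat split; auto.
      intros u v h1 h2 e'. apply NNPP. intros f. apply M. now exists u, v. }
    destruct (HF n x' y' f') as [s [Hs HH]].
    set (t := Rmin (Rmin (r - Rabs (x' - x)) (r - Rabs (y' - y))) (Rmin (s / 2) (r / 2))).
    assert (t <= r - Rabs (x' - x) /\ t <= r - Rabs (y' - y) /\ t <= s / 2 /\ t <= r / 2)
      as (t1 & t2 & t3 & t4).
    { unfold t. set (A := r - Rabs (x' - x)). set (B := r - Rabs (y' - y)).
      pose proof (Rmin_l (Rmin A B) (Rmin (s / 2) (r / 2))).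
      pose proof (Rmin_r (Rmin A B) (Rmin (s / 2) (r / 2))).
      pose proof (Rmin_l A B). pose proof (Rmin_r A B).
      pose proof (Rmin_l (s / 2) (r / 2)). pose proof (Rmin_r (s / 2) (r / 2)). lra. }
    assert (0 < t) by (unfold t; repeat apply Rmin_pos; lra).
    exists (x', y', t). intros _. simpl. repeat split; auto; try lra.
    intros u v hu hv. apply HH; lra. }
  set (next := fun n z => proj1_sig (constructive_indefinite_description _ (step n z))).
  assert (Hnext : forall n x y r, E x y -> 0 < r -> inner n (x, y, r) (next n (x, y, r))).
  { intros n x y r e Hr. unfold next.
    destruct (constructive_indefinite_description _ (step n (x, y, r))) as [w Hw]. simpl.
    apply Hw; auto. }
  set (z := fix z n := match n with O => (x0, y0, r0) | S n => next n (z n) end).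
  set (X := fun n => fst (fst (z n))). set (Y := fun n => snd (fst (z n))). set (r := fun n => snd (z n)).
  assert (Ez : forall n, z n = (X n, Y n, r n)).
  { intros n. unfold X, Y, r. now destruct (z n) as [[? ?] ?]. }
  assert (Inv : forall n, E (X n) (Y n) /\ 0 < r n).
  { induction n as [|n [e Hr]]; [now simpl|].
    pose proof (Hnext n _ _ _ e Hr) as I. rewrite <- Ez in I. change (next n (z n)) with (z (S n)) in I.
    rewrite !Ez in I. simpl in I. tauto. }
  assert (St : forall n, r (S n) <= r n / 2 /\ Rabs (X (S n) - X n) <= r n - r (S n) /\
     Rabs (Y (S n) - Y n) <= r n - r (S n) /\
     forall u v, Rabs (u - X (S n)) <= r (S n) -> Rabs (v - Y (S n)) <= r (S n) -> ~ F n u v).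
  { intros n. destruct (Inv n) as [e Hr].
    pose proof (Hnext n _ _ _ e Hr) as I. rewrite <- Ez in I. change (next n (z n)) with (z (S n)) in I.
    rewrite !Ez in I. simpl in I. tauto. }
  assert (Nest : forall n k, Rabs (X (n + k)%nat - X n) <= r n - r (n + k)%nat /\
     Rabs (Y (n + k)%nat - Y n) <= r n - r (n + k)%nat).
  { intros n. induction k as [|k [I1 I2]].
    - rewrite Nat.add_0_r, !Rminus_diag, Rabs_R0. lra.
    - rewrite Nat.add_succ_r. destruct (St (n + k)%nat) as (_ & s1 & s2 & _).
      apply Rabs_le_between in I1, I2, s1, s2. split; apply Rabs_le_between; lra. }
  assert (Lim : forall W : nat -> R,
     (forall n k, Rabs (W (n + k)%nat - W n) <= r n - r (n + k)%nat) ->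
     exists l, forall n, Rabs (l - W n) <= r n).
  { intros W HW.
    assert (C : forall n m, W n - r n <= W m + r m).
    { intros n m. destruct (Inv n) as [_ Hn], (Inv m) as [_ Hm].
      destruct (Nat.le_ge_cases n m) as [L|L].
      - specialize (HW n (m - n)%nat). replace (n + (m - n))%nat with m in HW by lia.
        apply Rabs_le_between in HW. lra.
      - specialize (HW m (n - m)%nat). replace (m + (n - m))%nat with n in HW by lia.
        apply Rabs_le_between in HW. lra. }
    (* A common point of the nested intervals: the supremum of their left endpoints. *)
    destruct (completeness (fun t => exists n, t = W n - r n)) as [l [l1 l2]].
    - exists (W O + r O). intros t [n ->]. apply C.
    - exists (W O - r O), O. reflexivity.
    - exists l. intros n. apply Rabs_le_between. split.
      + assert (W n - r n <= l) by (apply l1; eauto). lra.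
      + assert (l <= W n + r n) by (apply l2; intros t [m ->]; apply C). lra. }
  destruct (Lim X ltac:(intros; apply Nest)) as [x Hx].
  destruct (Lim Y ltac:(intros; apply Nest)) as [y Hy].
  assert (Exy : E x y).
  { apply NNPP. intros M. destruct (HE x y M) as [s [Hs HH]].
    assert (Hr : forall n, r n <= r0 * / 2 ^ n).
    { induction n as [|n IH]; [simpl; unfold r; simpl; lra|].
      destruct (St n) as [I _]. simpl. rewrite Rinv_mult. lra. }
    destruct (Pow_x_infinity 2 ltac:(rewrite Rabs_pos_eq; lra) (r0 / s + 1)) as [n Hn].
    specialize (Hn n (Nat.le_refl n)). rewrite Rabs_pos_eq in Hn by (apply pow_le; lra).
    specialize (Hr n).
    assert (0 < 2 ^ n) by (apply pow_lt; lra).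
    assert (r n < s).
    { apply Rle_lt_trans with (1 := Hr). apply Rmult_lt_reg_r with (2 ^ n); auto.
      rewrite Rmult_assoc, Rinv_l, Rmult_1_r by lra.
      replace r0 with (s * (r0 / s)) at 1 by (field; lra). apply Rmult_lt_compat_l; lra. }
    apply (HH (X n) (Y n)); [rewrite Rabs_minus_sym|rewrite Rabs_minus_sym|apply Inv].
    - specialize (Hx n); lra.
    - specialize (Hy n); lra. }
  destruct (Hcov x y (Hx O) (Hy O) Exy) as [n Hn].
  destruct (St n) as (_ & _ & _ & M). apply (M x y); auto.
Qed.

Definition open2 (U : R -> R -> Prop) : Prop :=
  forall x y, U x y -> exists r, 0 < r /\
    forall x' y', Rabs (x' - x) < r -> Rabs (y' - y) < r -> U x' y'.

Definition dq1 (p : R -> R -> R) (h x y : R) : R := (p (x + h) y - p x y) / h.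
Definition dq2 (p : R -> R -> R) (h x y : R) : R := (p x (y + h) - p x y) / h.

Lemma continuity_2d_pt_dq1 p h x y :
  continuity_2d_pt p x y -> continuity_2d_pt p (x + h) y -> continuity_2d_pt (dq1 p h) x y.
Proof.
  intros H1 H2. unfold dq1, Rdiv. apply continuity_2d_pt_mult; [|apply continuity_2d_pt_const].
  apply continuity_2d_pt_minus; auto.
  intros e. destruct (H2 e) as [r Hr]. exists r. intros u v hu hv. apply Hr; auto.
  now replace (u + h - (x + h)) with (u - x) by ring.
Qed.

Lemma continuity_2d_pt_dq2 p h x y :
  continuity_2d_pt p x y -> continuity_2d_pt p x (y + h) -> continuity_2d_pt (dq2 p h) x y.
Proof.
  intros H1 H2. unfold dq2, Rdiv. apply continuity_2d_pt_mult; [|apply continuity_2d_pt_const].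
  apply continuity_2d_pt_minus; auto.
  intros e. destruct (H2 e) as [r Hr]. exists r. intros u v hu hv. apply Hr; auto.
  now replace (v + h - (y + h)) with (v - y) by ring.
Qed.

(** Comparing difference quotients with each other, and not with the derivatives, gives for fixed
    [h] and [k] a closed condition on the point, although the partial derivatives may be
    discontinuous. The last clause carries [p_x = q_y]. The first keeps all the quotients inside
    [U]. *)
Definition tame (p q : R -> R -> R) (U : R -> R -> Prop) (e del x y : R) : Prop :=
  (forall x' y', Rabs (x' - x) < del -> Rabs (y' - y) < del -> U x' y') /\
  forall h k, h <> 0 -> k <> 0 -> Rabs h < del -> Rabs k < del ->
    Rabs (dq1 p h x y - dq1 p k x y) <= e /\ Rabs (dq2 p h x y - dq2 p k x y) <= e /\
    Rabs (dq1 q h x y - dq1 q k x y) <= e /\ Rabs (dq2 q h x y - dq2 q k x y) <= e /\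
    Rabs (dq1 p h x y - dq2 q k x y) <= e.

Lemma gap_open (f g : R -> R -> R) e x y :
  continuity_2d_pt f x y -> continuity_2d_pt g x y -> ~ Rabs (f x y - g x y) <= e ->
  exists r, 0 < r /\ forall x' y', Rabs (x' - x) < r -> Rabs (y' - y) < r ->
    ~ Rabs (f x' y' - g x' y') <= e.
Proof.
  intros Hf Hg N. apply Rnot_le_lt in N.
  pose proof (continuity_2d_pt_minus _ _ _ _ Hf Hg) as H.
  destruct (H (mkposreal _ (proj2 (Rlt_0_minus _ _) N))) as [r Hr]. simpl in Hr.
  exists r. split; [apply cond_pos|]. intros x' y' h1 h2.
  specialize (Hr x' y' h1 h2). apply Rlt_not_le.
  pose proof (Rabs_triang_inv (f x y - g x y) (f x' y' - g x' y')) as T.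
  rewrite (Rabs_minus_sym (f x y - g x y)) in T. lra.
Qed.

(** A failure is witnessed by a single pair of steps or by a single point outside [U], and either
    witness persists at nearby points. *)
Lemma closed_tame p q U e del :
  (forall x y, U x y -> continuity_2d_pt p x y) -> (forall x y, U x y -> continuity_2d_pt q x y) ->
  0 < del -> closed2 (tame p q U e del).
Proof.
  intros Hp Hq Hdel x y N.
  destruct (classic (forall x' y', Rabs (x' - x) < del -> Rabs (y' - y) < del -> U x' y')) as [HU|HU].
  - assert (U0 : U x y) by (apply HU; rewrite Rminus_diag, Rabs_R0; auto).
    assert (U1 : forall h, Rabs h < del -> U (x + h) y).
    { intros h hh. apply HU; [now replace (x + h - x) with h by ring|].
      rewrite Rminus_diag, Rabs_R0; auto. }
    assert (U2 : forall h, Rabs h < del -> U x (y + h)).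
    { intros h hh. apply HU; [rewrite Rminus_diag, Rabs_R0; auto|].
      now replace (y + h - y) with h by ring. }
    assert (exists h k, h <> 0 /\ k <> 0 /\ Rabs h < del /\ Rabs k < del /\
      ~ (Rabs (dq1 p h x y - dq1 p k x y) <= e /\ Rabs (dq2 p h x y - dq2 p k x y) <= e /\
    Rabs (dq1 q h x y - dq1 q k x y) <= e /\ Rabs (dq2 q h x y - dq2 q k x y) <= e /\
    Rabs (dq1 p h x y - dq2 q k x y) <= e)) as (h & k & h0 & k0 & hd & kd & M).
    { apply NNPP. intros M. apply N. split; auto. intros h k h0 k0 hd kd.
      apply NNPP. intros M'. apply M. exists h, k. tauto. }
    assert (C1 : forall h, Rabs h < del -> continuity_2d_pt (dq1 p h) x y)
      by (intros; apply continuity_2d_pt_dq1; auto).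
    assert (C2 : forall h, Rabs h < del -> continuity_2d_pt (dq2 p h) x y)
      by (intros; apply continuity_2d_pt_dq2; auto).
    assert (C3 : forall h, Rabs h < del -> continuity_2d_pt (dq1 q h) x y)
      by (intros; apply continuity_2d_pt_dq1; auto).
    assert (C4 : forall h, Rabs h < del -> continuity_2d_pt (dq2 q h) x y)
      by (intros; apply continuity_2d_pt_dq2; auto).
    assert (D : exists r, 0 < r /\ forall x' y', Rabs (x' - x) < r -> Rabs (y' - y) < r ->
      ~ (Rabs (dq1 p h x' y' - dq1 p k x' y') <= e /\ Rabs (dq2 p h x' y' - dq2 p k x' y') <= e /\
    Rabs (dq1 q h x' y' - dq1 q k x' y') <= e /\ Rabs (dq2 q h x' y' - dq2 q k x' y') <= e /\
    Rabs (dq1 p h x' y' - dq2 q k x' y') <= e)).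
    { repeat (apply not_and_or in M; destruct M as [M|M]);
        (eapply gap_open in M; [|solve [auto]|solve [auto]]);
        destruct M as [r [Hr M]]; exists r; (split; [auto|]); intros x' y' g1 g2;
        specialize (M x' y' g1 g2); tauto. }
    destruct D as [r [Hr D]]. exists r; split; auto.
    intros x' y' g1 g2 [_ T]. apply (D x' y' g1 g2), T; auto.
  - assert (exists u v, Rabs (u - x) < del /\ Rabs (v - y) < del /\ ~ U u v) as (u & v & hu & hv & M).
    { apply NNPP. intros M. apply HU. intros u v hu hv. apply NNPP. intros M'. apply M. eauto. }
    exists (Rmin (del - Rabs (u - x)) (del - Rabs (v - y))). split; [apply Rmin_pos; lra|].
    intros x' y' g1 g2 [T _]. apply M, T.
    + pose proof (Rmin_l (del - Rabs (u - x)) (del - Rabs (v - y))).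
      replace (u - x') with ((u - x) + - (x' - x)) by ring.
      eapply Rle_lt_trans; [apply Rabs_triang|]. rewrite Rabs_Ropp. lra.
    + pose proof (Rmin_r (del - Rabs (u - x)) (del - Rabs (v - y))).
      replace (v - y') with ((v - y) + - (y' - y)) by ring.
      eapply Rle_lt_trans; [apply Rabs_triang|]. rewrite Rabs_Ropp. lra.
Qed.

(** The shared derivative [a] is the closedness condition [p_x = q_y] of the form [q dx + p dy]. *)
Definition balanced (p q : R -> R -> R) (x y : R) : Prop :=
  continuity_2d_pt p x y /\ continuity_2d_pt q x y /\
  exists a b c, derivable_pt_lim (fun s => p s y) x a /\ derivable_pt_lim (fun s => p x s) y b /\
    derivable_pt_lim (fun s => q s y) x c /\ derivable_pt_lim (fun s => q x s) y a.

Lemma balanced_tame p q U e x y :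
  open2 U -> U x y -> balanced p q x y -> 0 < e ->
  exists n, tame p q U e (/ (INR n + 1)) x y.
Proof.
  intros HU Uxy (_ & _ & a & b & c & Da & Db & Dc & Dd) He.
  destruct (HU x y Uxy) as [r [Hr H]].
  destruct (Da (e / 2) ltac:(lra)) as [r1 H1]. destruct (Db (e / 2) ltac:(lra)) as [r2 H2].
  destruct (Dc (e / 2) ltac:(lra)) as [r3 H3]. destruct (Dd (e / 2) ltac:(lra)) as [r4 H4].
  set (m := Rmin r (Rmin (Rmin r1 r2) (Rmin r3 r4))).
  assert (m <= r /\ m <= r1 /\ m <= r2 /\ m <= r3 /\ m <= r4) as (m0 & m1 & m2 & m3 & m4).
  { unfold m. pose proof (Rmin_l r (Rmin (Rmin r1 r2) (Rmin r3 r4))).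
    pose proof (Rmin_r r (Rmin (Rmin r1 r2) (Rmin r3 r4))).
    pose proof (Rmin_l (Rmin r1 r2) (Rmin r3 r4)). pose proof (Rmin_r (Rmin r1 r2) (Rmin r3 r4)).
    pose proof (Rmin_l r1 r2). pose proof (Rmin_r r1 r2).
    pose proof (Rmin_l r3 r4). pose proof (Rmin_r r3 r4). lra. }
  assert (0 < m) by (unfold m; repeat apply Rmin_pos; auto using cond_pos).
  destruct (nfloor_ex (/ m)) as [n Hn]; [left; now apply Rinv_0_lt_compat|].
  exists n. set (del := / (INR n + 1)).
  assert (del < m).
  { unfold del. rewrite <- (Rinv_inv m). apply Rinv_lt_contravar; [|lra].
    pose proof (pos_INR n). apply Rmult_lt_0_compat; [now apply Rinv_0_lt_compat|lra]. }
  split.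
  - intros; apply H; lra.
  - intros h k h0 k0 hd kd.
    pose proof (H1 h h0 ltac:(lra)). pose proof (H1 k k0 ltac:(lra)).
    pose proof (H2 h h0 ltac:(lra)). pose proof (H2 k k0 ltac:(lra)).
    pose proof (H3 h h0 ltac:(lra)). pose proof (H3 k k0 ltac:(lra)).
    pose proof (H4 h h0 ltac:(lra)). pose proof (H4 k k0 ltac:(lra)).
    unfold dq1, dq2.
    repeat match goal with H : Rabs _ < e / 2 |- _ => apply Rabs_lt_between in H end.
    repeat split; apply Rabs_le_between; lra.
Qed.

Definition locally_small (p q : R -> R -> R) (eps x y : R) : Prop :=
  exists r, 0 < r /\ forall a b c d, a <= b -> c <= d ->
    x - r < a -> b < x + r -> y - r < c -> d < y + r ->
    Rabs (circ p q a b c d) <= eps * ((b - a) * (d - c)).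

Lemma closed_not_locally_small p q eps : closed2 (fun x y => ~ locally_small p q eps x y).
Proof.
  intros x y N. apply NNPP in N. destruct N as [r [Hr H]].
  exists (r / 2). split; [lra|]. intros x' y' h1 h2 M. apply M.
  apply Rabs_lt_between in h1, h2.
  exists (r / 2). split; [lra|]. intros. apply H; lra.
Qed.

Lemma balanced_locally_small p q U eps :
  open2 U -> (forall x y, U x y -> balanced p q x y) -> 0 < eps ->
  forall x y, U x y -> locally_small p q eps x y.
Proof.
  intros HU Hb Heps x0 y0 U0. apply NNPP. intros N0.
  set (E := fun x y => ~ locally_small p q eps x y).
  (* The tolerance demanded by [portion_area]. *)
  set (e := eps / 520).
  assert (He : 0 < e) by (unfold e; lra).
  assert (Cp : forall x y, U x y -> continuity_2d_pt p x y) by (intros; now apply Hb).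
  assert (Cq : forall x y, U x y -> continuity_2d_pt q x y) by (intros; now apply Hb).
  assert (Hpos : forall n, 0 < / (INR n + 1)).
  { intros n. pose proof (pos_INR n). apply Rinv_0_lt_compat. lra. }
  destruct (HU x0 y0 U0) as [r0 [Hr0 B0]].
  destruct (baire_portion E (fun n => tame p q U e (/ (INR n + 1))) x0 y0 (r0 / 2))
    as (n & x1 & y1 & r1 & Hr1 & E1 & HE); auto; try lra.
  { apply closed_not_locally_small. }
  { intros n. apply closed_tame; auto. }
  { intros x y hx hy _. assert (U x y) by (apply B0; lra). apply balanced_tame; auto. }
  set (del := / (INR n + 1)) in *. assert (Hdel : 0 < del) by apply Hpos.
  assert (T1 : tame p q U e del x1 y1).
  { apply HE; auto; rewrite Rminus_diag, Rabs_R0; auto. }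
  destruct T1 as [TU TD].
  set (h0 := del / 2).
  assert (Hh0 : h0 <> 0 /\ Rabs h0 < del) by (unfold h0; rewrite Rabs_pos_eq; lra).
  assert (Ux1 : U x1 y1) by (apply TU; rewrite Rminus_diag, Rabs_R0; auto).
  assert (Ux2 : U (x1 + h0) y1).
  { apply TU; [replace (x1 + h0 - x1) with h0 by ring; tauto|]. rewrite Rminus_diag, Rabs_R0; auto. }
  assert (Ux3 : U x1 (y1 + h0)).
  { apply TU; [rewrite Rminus_diag, Rabs_R0; auto|]. replace (y1 + h0 - y1) with h0 by ring; tauto. }
  set (ee := mkposreal e He).
  destruct (continuity_2d_pt_dq1 p h0 x1 y1 ltac:(auto) ltac:(auto) ee) as [[s1 P1] S1].
  destruct (continuity_2d_pt_dq2 p h0 x1 y1 ltac:(auto) ltac:(auto) ee) as [[s2 P2] S2].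
  destruct (continuity_2d_pt_dq1 q h0 x1 y1 ltac:(auto) ltac:(auto) ee) as [[s3 P3] S3].
  destruct (continuity_2d_pt_dq2 q h0 x1 y1 ltac:(auto) ltac:(auto) ee) as [[s4 P4] S4].
  simpl in S1, S2, S3, S4.
  set (m := Rmin (Rmin r1 (del / 4)) (Rmin (Rmin s1 s2) (Rmin s3 s4))).
  assert (m <= r1 /\ m <= del / 4 /\ m <= s1 /\ m <= s2 /\ m <= s3 /\ m <= s4) as (m1 & m2 & m3 & m4 & m5 & m6).
  { unfold m. pose proof (Rmin_l (Rmin r1 (del / 4)) (Rmin (Rmin s1 s2) (Rmin s3 s4))).
    pose proof (Rmin_r (Rmin r1 (del / 4)) (Rmin (Rmin s1 s2) (Rmin s3 s4))).
    pose proof (Rmin_l r1 (del / 4)). pose proof (Rmin_r r1 (del / 4)).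
    pose proof (Rmin_l (Rmin s1 s2) (Rmin s3 s4)). pose proof (Rmin_r (Rmin s1 s2) (Rmin s3 s4)).
    pose proof (Rmin_l s1 s2). pose proof (Rmin_r s1 s2).
    pose proof (Rmin_l s3 s4). pose proof (Rmin_r s3 s4). lra. }
  assert (0 < m) by (unfold m; repeat apply Rmin_pos; lra).
  set (r := m / 2).
  set (X0 := x1 - r). set (X1 := x1 + r). set (Y0 := y1 - r). set (Y1 := y1 + r).
  assert (UB : forall x y, X0 <= x <= X1 -> Y0 <= y <= Y1 -> U x y).
  { intros x y hx hy. unfold X0, X1, Y0, Y1, r in *. apply TU; apply Rabs_lt_between; lra. }
  assert (Lin : forall D A h v0 v1, v1 - v0 = D * h -> Rabs (D - A) <= 2 * e ->
     Rabs (v1 - v0 - A * h) <= 2 * e * Rabs h).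
  { intros D A h v0 v1 -> HD. replace (D * h - A * h) with ((D - A) * h) by ring.
    rewrite Rabs_mult. apply Rmult_le_compat_r; auto using Rabs_pos. }
  assert (Near : forall x y h, X0 <= x <= X1 -> Y0 <= y <= Y1 -> E x y -> h <> 0 -> Rabs h < del ->
     Rabs (dq1 p h x y - dq1 p h0 x1 y1) <= 2 * e /\ Rabs (dq2 p h x y - dq2 p h0 x1 y1) <= 2 * e /\
     Rabs (dq1 q h x y - dq1 q h0 x1 y1) <= 2 * e /\ Rabs (dq2 q h x y - dq2 q h0 x1 y1) <= 2 * e).
  { intros x y h hx hy k hh hd. unfold X0, X1, Y0, Y1, r in *.
    assert (ax : Rabs (x - x1) < m) by (apply Rabs_lt_between; lra).
    assert (ay : Rabs (y - y1) < m) by (apply Rabs_lt_between; lra).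
    destruct (HE x y ltac:(lra) ltac:(lra) k) as [_ T].
    destruct (T h h0 hh (proj1 Hh0) hd (proj2 Hh0)) as (t1 & t2 & t3 & t4 & _).
    specialize (S1 x y ltac:(lra) ltac:(lra)). specialize (S2 x y ltac:(lra) ltac:(lra)).
    specialize (S3 x y ltac:(lra) ltac:(lra)). specialize (S4 x y ltac:(lra) ltac:(lra)).
    apply Rabs_le_between in t1, t2, t3, t4. apply Rabs_lt_between in S1, S2, S3, S4.
    repeat split; apply Rabs_le_between; lra. }
  assert (P : portion p q E (dq1 p h0 x1 y1) (dq2 p h0 x1 y1) (dq1 q h0 x1 y1) (dq2 q h0 x1 y1)
     e eps X0 X1 Y0 Y1).
  { constructor.
    - intros x y hx hy. auto.
    - intros x y hx hy. auto.
    - apply closed_not_locally_small.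
    - lra.
    - apply (TD h0 h0); tauto.
    - intros x x' y hx hx' hy k. destruct (Req_dec x' x) as [->|Hn].
      { rewrite !Rminus_diag, Rmult_0_r, Rminus_diag, Rabs_R0. lra. }
      apply Lin with (dq1 p (x' - x) x y).
      { unfold dq1. replace (x + (x' - x)) with x' by ring. field. lra. }
      apply Near; auto; [lra|]. unfold X0, X1, r in *. apply Rabs_lt_between; lra.
    - intros x y y' hx hy hy' k. destruct (Req_dec y' y) as [->|Hn].
      { rewrite !Rminus_diag, Rmult_0_r, Rminus_diag, Rabs_R0. lra. }
      apply Lin with (dq2 p (y' - y) x y).
      { unfold dq2. replace (y + (y' - y)) with y' by ring. field. lra. }
      apply Near; auto; [lra|]. unfold Y0, Y1, r in *. apply Rabs_lt_between; lra.
    - intros x x' y hx hx' hy k. destruct (Req_dec x' x) as [->|Hn].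
      { rewrite !Rminus_diag, Rmult_0_r, Rminus_diag, Rabs_R0. lra. }
      apply Lin with (dq1 q (x' - x) x y).
      { unfold dq1. replace (x + (x' - x)) with x' by ring. field. lra. }
      apply Near; auto; [lra|]. unfold X0, X1, r in *. apply Rabs_lt_between; lra.
    - intros x y y' hx hy hy' k. destruct (Req_dec y' y) as [->|Hn].
      { rewrite !Rminus_diag, Rmult_0_r, Rminus_diag, Rabs_R0. lra. }
      apply Lin with (dq2 q (y' - y) x y).
      { unfold dq2. replace (y + (y' - y)) with y' by ring. field. lra. }
      apply Near; auto; [lra|]. unfold Y0, Y1, r in *. apply Rabs_lt_between; lra.
    (* Off [E] the area bound holds near every point by the definition of [E], and bisection makes
       it global. *)
    - intros a b c d g1 g2 g3 g4 g5 g6 Hfree. apply circ_area_of_local; auto.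
      + intros x y hx hy. apply Cp, UB; lra.
      + intros x y hx hy. apply Cq, UB; lra.
      + intros x y hx hy. destruct (NNPP _ (Hfree x y hx hy)) as [s [Hs HH]].
        exists s; split; auto. }
  apply E1. exists r. split; [unfold r; lra|].
  intros a b c d hab hcd g1 g2 g3 g4. eapply portion_area; [exact P|..]; unfold e, X0, X1, Y0, Y1; lra.
Qed.

Lemma looman_menchoff p q U a b c d :
  open2 U -> (forall x y, U x y -> balanced p q x y) -> a <= b -> c <= d ->
  (forall x y, a <= x <= b -> c <= y <= d -> U x y) ->
  circ p q a b c d = 0.
Proof.
  intros HU Hb Hab Hcd HR.
  assert (H : forall eps, 0 < eps -> Rabs (circ p q a b c d) <= eps * ((b - a) * (d - c))).
  { intros eps He. apply circ_area_of_local; auto.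
    - intros x y hx hy. now apply Hb, HR.
    - intros x y hx hy. now apply Hb, HR.
    - intros x y hx hy.
      destruct (balanced_locally_small p q U eps HU Hb He x y (HR x y hx hy)) as [r [Hr H]].
      exists r; split; auto. }
  destruct (Req_dec (circ p q a b c d) 0) as [|N]; auto. exfalso.
  apply Rabs_pos_lt in N. set (z := Rabs (circ p q a b c d)) in *.
  set (S := (b - a) * (d - c)) in *. assert (0 <= S) by (apply Rmult_le_pos; lra).
  specialize (H (z / (2 * (S + 1))) ltac:(apply Rdiv_lt_0_compat; lra)).
  assert (z / (2 * (S + 1)) * S < z); [|lra].
  replace z with (z / (2 * (S + 1)) * (2 * (S + 1))) at 2 by (field; lra).
  apply Rmult_lt_compat_l; [apply Rdiv_lt_0_compat; lra|lra].
Qed.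

(** * The maximum principle for real parts *)

(* Pointwise, [u + i v] being continuous with complex derivative [a + i b] along both axes. *)
Definition holo (u v : R -> R -> R) (x y : R) : Prop :=
  continuity_2d_pt u x y /\ continuity_2d_pt v x y /\
  exists a b, derivable_pt_lim (fun s => u s y) x a /\ derivable_pt_lim (fun s => u x s) y (- b) /\
    derivable_pt_lim (fun s => v s y) x b /\ derivable_pt_lim (fun s => v x s) y a.

(** [circ u v] is the imaginary part of the integral of [(u + i v) dz], so Looman-Menchoff yields
    the imaginary half of Cauchy's theorem. *)
Lemma holo_balanced u v x y : holo u v x y -> balanced u v x y.
Proof.
  intros (Cu & Cv & a & b & H1 & H2 & H3 & H4). split; [auto|split; [auto|]].
  exists a, (- b), b. auto.
Qed.

Lemma holo_const a b x y : holo (fun _ _ => a) (fun _ _ => b) x y.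
Proof.
  split; [|split]; try apply continuity_2d_pt_const. exists 0, 0.
  rewrite Ropp_0. repeat split; apply derivable_pt_lim_const.
Qed.

Lemma holo_id x y : holo (fun x _ => x) (fun _ y => y) x y.
Proof.
  split; [apply continuity_2d_pt_id1|split; [apply continuity_2d_pt_id2|]].
  exists 1, 0. rewrite Ropp_0. repeat split; solve [apply derivable_pt_lim_id | apply derivable_pt_lim_const].
Qed.

Lemma holo_plus u v u' v' x y : holo u v x y -> holo u' v' x y ->
  holo (fun x y => u x y + u' x y) (fun x y => v x y + v' x y) x y.
Proof.
  intros (Cu & Cv & a & b & H1 & H2 & H3 & H4) (Cu' & Cv' & a' & b' & H1' & H2' & H3' & H4').
  split; [|split]; try (apply continuity_2d_pt_plus; auto).
  exists (a + a'), (b + b'). rewrite Ropp_plus_distr.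
  repeat split; apply derivable_pt_lim_plus; auto.
Qed.

Lemma derivable_pt_lim_eq f x l l' : derivable_pt_lim f x l -> l = l' -> derivable_pt_lim f x l'.
Proof. now intros H <-. Qed.

Lemma holo_mult u v u' v' x y : holo u v x y -> holo u' v' x y ->
  holo (fun x y => u x y * u' x y - v x y * v' x y) (fun x y => u x y * v' x y + v x y * u' x y) x y.
Proof.
  intros (Cu & Cv & a & b & H1 & H2 & H3 & H4) (Cu' & Cv' & a' & b' & H1' & H2' & H3' & H4').
  split; [apply continuity_2d_pt_minus|split; [apply continuity_2d_pt_plus|]];
    try (apply continuity_2d_pt_mult; auto).
  exists (a * u' x y + u x y * a' - (b * v' x y + v x y * b')),
    (a * v' x y + u x y * b' + (b * u' x y + v x y * a')).
  repeat split; (eapply derivable_pt_lim_eq;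
    [first [apply derivable_pt_lim_minus | apply derivable_pt_lim_plus];
       apply derivable_pt_lim_mult; eassumption|cbv beta; ring]).
Qed.

Lemma holo_exp u v x y : holo u v x y ->
  holo (fun x y => exp (u x y) * cos (v x y)) (fun x y => exp (u x y) * sin (v x y)) x y.
Proof.
  intros (Cu & Cv & a & b & H1 & H2 & H3 & H4).
  split; [|split].
  - apply continuity_2d_pt_mult; apply continuity_1d_2d_pt_comp; auto;
      apply derivable_continuous_pt; [apply derivable_pt_exp|apply derivable_pt_cos].
  - apply continuity_2d_pt_mult; apply continuity_1d_2d_pt_comp; auto;
      apply derivable_continuous_pt; [apply derivable_pt_exp|apply derivable_pt_sin].
  - exists (exp (u x y) * (a * cos (v x y) - b * sin (v x y))),
      (exp (u x y) * (a * sin (v x y) + b * cos (v x y))).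
    assert (D : forall (f g : R -> R) t c d, derivable_pt_lim f t c -> derivable_pt_lim g t d ->
      derivable_pt_lim (fun s => exp (f s) * cos (g s)) t (exp (f t) * (c * cos (g t) - d * sin (g t))) /\
      derivable_pt_lim (fun s => exp (f s) * sin (g s)) t (exp (f t) * (c * sin (g t) + d * cos (g t)))).
    { intros f g t c d Hf Hg.
      pose proof (derivable_pt_lim_comp f exp t _ _ Hf (derivable_pt_lim_exp _)) as E.
      pose proof (derivable_pt_lim_comp g cos t _ _ Hg (derivable_pt_lim_cos _)) as Ec.
      pose proof (derivable_pt_lim_comp g sin t _ _ Hg (derivable_pt_lim_sin _)) as Es.
      split; [eapply derivable_pt_lim_eq; [exact (derivable_pt_lim_mult _ _ t _ _ E Ec)|]
             |eapply derivable_pt_lim_eq; [exact (derivable_pt_lim_mult _ _ t _ _ E Es)|]];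
        unfold comp; ring. }
    destruct (D _ _ _ _ _ H1 H3) as [D1 D2]. destruct (D _ _ _ _ _ H2 H4) as [D3 D4].
    repeat split; auto; (eapply derivable_pt_lim_eq; [eassumption|ring]).
Qed.

(** The components of [1 / (z - z0)]. *)
Lemma holo_inv x y x0 y0 : (x, y) <> (x0, y0) ->
  holo (fun x y => (x - x0) / ((x - x0) ^ 2 + (y - y0) ^ 2))
       (fun x y => - (y - y0) / ((x - x0) ^ 2 + (y - y0) ^ 2)) x y.
Proof.
  intros N.
  assert (H : (x - x0) ^ 2 + (y - y0) ^ 2 <> 0).
  { intros Z. apply N. pose proof (pow2_ge_0 (x - x0)). pose proof (pow2_ge_0 (y - y0)).
    f_equal; nra. }
  assert (C1 : continuity_2d_pt (fun x _ => x - x0) x y)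
    by (apply continuity_2d_pt_minus; [apply continuity_2d_pt_id1|apply continuity_2d_pt_const]).
  assert (C2 : continuity_2d_pt (fun _ y => y - y0) x y)
    by (apply continuity_2d_pt_minus; [apply continuity_2d_pt_id2|apply continuity_2d_pt_const]).
  assert (C3 : continuity_2d_pt (fun x y => / ((x - x0) ^ 2 + (y - y0) ^ 2)) x y).
  { apply continuity_2d_pt_inv; auto.
    apply (continuity_2d_pt_ext (fun x y => (x - x0) * (x - x0) + (y - y0) * (y - y0))).
    { intros; ring. }
    apply continuity_2d_pt_plus; apply continuity_2d_pt_mult; auto. }
  split; [|split].
  - apply continuity_2d_pt_mult; auto.
  - apply continuity_2d_pt_mult; auto. now apply continuity_2d_pt_opp.
  - set (D := (x - x0) ^ 2 + (y - y0) ^ 2) in *.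
    exists (((y - y0) ^ 2 - (x - x0) ^ 2) / D ^ 2), (2 * (x - x0) * (y - y0) / D ^ 2).
    repeat split; apply is_derive_Reals; auto_derive; try exact H; unfold D in *; field; exact H.
Qed.

(** The frame between the two squares consists of four rectangles avoiding the centre. The cuts use
    integrability along their sides, as the field may blow up at the centre. *)
Lemma holo_punctured_annulus (g1 g2 : R -> R -> R) (U : R -> R -> Prop) x0 y0 s t :
  open2 U -> (forall x y, U x y -> (x, y) <> (x0, y0) -> holo g1 g2 x y) -> 0 < t -> t < s ->
  (forall x y, x0 - s <= x <= x0 + s -> y0 - s <= y <= y0 + s -> U x y) ->
  circ g1 g2 (x0 - s) (x0 + s) (y0 - s) (y0 + s) = circ g1 g2 (x0 - t) (x0 + t) (y0 - t) (y0 + t).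
Proof.
  intros HU Hg Ht Hs HQ.
  set (V := fun x y => U x y /\ (x, y) <> (x0, y0)).
  assert (HV : open2 V).
  { intros x y [Uxy N]. destruct (HU x y Uxy) as [r [Hr H]].
    assert (exists k, 0 < k /\ (Rabs (x - x0) >= k \/ Rabs (y - y0) >= k)) as [k [Hk D]].
    { destruct (Req_dec x x0) as [->|Nx].
      - exists (Rabs (y - y0)). split; [|right; lra].
        apply Rabs_pos_lt. intros Z. apply N. f_equal; lra.
      - exists (Rabs (x - x0)). split; [|left; lra]. apply Rabs_pos_lt. lra. }
    exists (Rmin r k). split; [now apply Rmin_pos|]. intros x' y' h1 h2.
    pose proof (Rmin_l r k). pose proof (Rmin_r r k). split; [apply H; lra|].
    intros E. injection E as -> ->. rewrite Rabs_minus_sym in h1, h2. lra. }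
  assert (HB : forall x y, V x y -> balanced g1 g2 x y).
  { intros x y [? ?]. apply holo_balanced; auto. }
  assert (Z : forall a b c d, a <= b -> c <= d -> x0 - s <= a -> b <= x0 + s -> y0 - s <= c -> d <= y0 + s ->
     (x0 < a \/ b < x0) \/ (y0 < c \/ d < y0) -> circ g1 g2 a b c d = 0).
  { intros a b c d h1 h2 h3 h4 h5 h6 D. apply (looman_menchoff g1 g2 V); auto.
    intros x y hx hy. split; [apply HQ; lra|]. intros E. injection E as -> ->. lra. }
  assert (Col : forall g a c d, (forall x y, V x y -> continuity_2d_pt g x y) ->
     x0 - s <= a <= x0 + s -> a <> x0 -> y0 - s <= c -> c <= d -> d <= y0 + s ->
     ex_RInt (fun y => g a y) c d).
  { intros g a c d Cg h1 h2 h3 h4 h5. apply (ex_RInt_continuous (V := R_CompleteNormedModule)).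
    intros z. rewrite Rmin_left, Rmax_right by lra. intros hz.
    apply continuity_2d_pt_r, Cg. split; [apply HQ; lra|]. congruence. }
  assert (Row : forall g a c d, (forall x y, V x y -> continuity_2d_pt g x y) ->
     y0 - s <= a <= y0 + s -> a <> y0 -> x0 - s <= c -> c <= d -> d <= x0 + s ->
     ex_RInt (fun x => g x a) c d).
  { intros g a c d Cg h1 h2 h3 h4 h5. apply (ex_RInt_continuous (V := R_CompleteNormedModule)).
    intros z. rewrite Rmin_left, Rmax_right by lra. intros hz.
    apply continuity_2d_pt_l, Cg. split; [apply HQ; lra|]. congruence. }
  assert (C1 : forall x y, V x y -> continuity_2d_pt g1 x y) by (intros; now apply HB).
  assert (C2 : forall x y, V x y -> continuity_2d_pt g2 x y) by (intros; now apply HB).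
  assert (Sx : forall a m b c d, x0 - s <= a -> a <= m -> m <= b -> b <= x0 + s ->
     y0 - s <= c -> c < y0 -> y0 < d -> d <= y0 + s -> a <> x0 -> m <> x0 -> b <> x0 ->
     circ g1 g2 a b c d = circ g1 g2 a m c d + circ g1 g2 m b c d).
  { intros a m b c d. intros. apply circ_chasles_x.
    1-3: apply (Col g1); [exact C1|lra..].
    all: apply (ex_RInt_minus (V := R_NormedModule)); apply (Row g2); first [exact C2|lra]. }
  assert (Sy : forall a b c m d, x0 - s <= a -> a < x0 -> x0 < b -> b <= x0 + s ->
     y0 - s <= c -> c <= m -> m <= d -> d <= y0 + s -> c <> y0 -> m <> y0 -> d <> y0 ->
     circ g1 g2 a b c d = circ g1 g2 a b c m + circ g1 g2 a b m d).
  { intros a b c m d. intros.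
    assert (T : circ (tr g2) (tr g1) c d a b = circ (tr g2) (tr g1) c m a b + circ (tr g2) (tr g1) m d a b).
    { apply circ_chasles_x; unfold tr.
      1-3: apply (Row g2); [exact C2|lra..].
      all: apply (ex_RInt_minus (V := R_NormedModule)); apply (Col g1); first [exact C1|lra]. }
    rewrite !circ_tr in T. lra. }
  rewrite (Sx (x0 - s) (x0 - t) (x0 + s)), (Sx (x0 - t) (x0 + t) (x0 + s)),
    (Sy (x0 - t) (x0 + t) (y0 - s) (y0 - t) (y0 + s)), (Sy (x0 - t) (x0 + t) (y0 - t) (y0 + t) (y0 + s)) by lra.
  rewrite (Z (x0 - s) (x0 - t)), (Z (x0 + t) (x0 + s)), (Z (x0 - t) (x0 + t) (y0 - s) (y0 - t)),
    (Z (x0 - t) (x0 + t) (y0 + t) (y0 + s)) by lra. ring.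
Qed.

Definition square_boundary (x0 y0 s x y : R) : Prop :=
  Rabs (x - x0) <= s /\ Rabs (y - y0) <= s /\ (Rabs (x - x0) = s \/ Rabs (y - y0) = s).

(* The imaginary part of the integral of [(f - f(z0)) / (z - z0)] over the boundary vanishes;
   its integrand would be negative throughout. *)
Lemma holo_center_small_boundary u v (U : R -> R -> Prop) x0 y0 s :
  open2 U -> (forall x y, U x y -> holo u v x y) -> 0 < s ->
  (forall x y, x0 - s <= x <= x0 + s -> y0 - s <= y <= y0 + s -> U x y) ->
  u x0 y0 = 1 -> v x0 y0 = 0 ->
  ~ (forall x y, square_boundary x0 y0 s x y -> Rabs (u x y) <= 1 / 8 /\ Rabs (v x y) <= 1 / 8).
Proof.
  intros HU Hf Hs HQ Hu Hv HB.
  set (i1 := fun x y => (x - x0) / ((x - x0) ^ 2 + (y - y0) ^ 2)).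
  set (i2 := fun x y => - (y - y0) / ((x - x0) ^ 2 + (y - y0) ^ 2)).
  set (g1 := fun x y => (u x y + - 1) * i1 x y - (v x y + 0) * i2 x y).
  set (g2 := fun x y => (u x y + - 1) * i2 x y + (v x y + 0) * i1 x y).
  assert (Hg : forall x y, U x y -> (x, y) <> (x0, y0) -> holo g1 g2 x y).
  { intros x y Uxy N. apply (holo_mult (fun x y => u x y + - 1) (fun x y => v x y + 0) i1 i2).
    - apply holo_plus; [auto|apply holo_const].
    - now apply holo_inv. }
  destruct (Hf x0 y0 ltac:(apply HQ; lra)) as (Cu & Cv & _).
  destruct (Cu (mkposreal (1 / 16) ltac:(lra))) as [[r1 P1] H1].
  destruct (Cv (mkposreal (1 / 16) ltac:(lra))) as [[r2 P2] H2]. simpl in H1, H2.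
  rewrite Hu in H1. rewrite Hv in H2.
  (* On the small square [f - f(z0)] is small by continuity; this replaces any discussion of the
     removable singularity. *)
  set (t := Rmin (s / 2) (Rmin (r1 / 2) (r2 / 2))).
  assert (0 < t) by (unfold t; repeat apply Rmin_pos; lra).
  assert (t <= s / 2 /\ t <= r1 / 2 /\ t <= r2 / 2) as (t0 & t1 & t2).
  { unfold t. pose proof (Rmin_l (s / 2) (Rmin (r1 / 2) (r2 / 2))).
    pose proof (Rmin_r (s / 2) (Rmin (r1 / 2) (r2 / 2))).
    pose proof (Rmin_l (r1 / 2) (r2 / 2)). pose proof (Rmin_r (r1 / 2) (r2 / 2)). lra. }
  pose proof (holo_punctured_annulus g1 g2 U x0 y0 s t HU Hg ltac:(lra) ltac:(lra) HQ) as E.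
  assert (K : forall k w A B l m, 0 < k -> - k <= w <= k -> l <= A - Rabs B -> A + Rabs B <= m ->
     l <= 0 -> l <= m ->
     l * / k <= (A * k + B * w) / (k ^ 2 + w ^ 2) /\
     (m <= 0 -> (A * k + B * w) / (k ^ 2 + w ^ 2) <= m / 2 * / k) /\
     (0 <= m -> (A * k + B * w) / (k ^ 2 + w ^ 2) <= m * / k)).
  { intros k w A B l m Hk Hw Hl Hm l0 lm.
    assert (Hw2 : w ^ 2 <= k ^ 2) by nra. assert (0 <= w ^ 2) by apply pow2_ge_0.
    assert (D : 0 < k ^ 2 + w ^ 2) by (pose proof (pow_lt k 2 Hk); lra).
    assert (BW : - (Rabs B * k) <= B * w <= Rabs B * k).
    { apply Rabs_le_between. rewrite Rabs_mult. apply Rmult_le_compat_l; [apply Rabs_pos|].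
      now apply Rabs_le_between. }
    assert (L1 : l * k <= A * k + B * w) by nra.
    assert (L2 : A * k + B * w <= m * k) by nra.
    replace (A * k + B * w) with ((A * k + B * w) / (k ^ 2 + w ^ 2) * (k ^ 2 + w ^ 2)) in L1, L2
      by (field; lra).
    set (q := (A * k + B * w) / (k ^ 2 + w ^ 2)) in *.
    assert (Hk' : 0 < / k) by now apply Rinv_0_lt_compat.
    assert (X : forall c, c * / k * (k * k) = c * k) by (intros; field; lra).
    repeat split; intros; (apply Rmult_le_reg_r with (k ^ 2 + w ^ 2); [auto|]).
    - eapply Rle_trans; [|exact L1]. specialize (X l).
      assert (l * / k * w ^ 2 <= 0); [|nra].
      assert (0 <= - l * / k * w ^ 2); [|lra]. apply Rmult_le_pos; auto. apply Rmult_le_pos; lra.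
    - eapply Rle_trans; [exact L2|]. specialize (X m).
      assert (0 <= - (m / 2) * / k * (k ^ 2 - w ^ 2)); [|nra].
      apply Rmult_le_pos; [|lra]. apply Rmult_le_pos; lra.
    - eapply Rle_trans; [exact L2|]. specialize (X m).
      assert (0 <= m * / k * w ^ 2); [|nra].
      apply Rmult_le_pos; auto. apply Rmult_le_pos; lra. }
  assert (G1r : forall k y, g1 (x0 + k) y =
     ((u (x0 + k) y - 1) * k + v (x0 + k) y * (y - y0)) / (k ^ 2 + (y - y0) ^ 2)).
  { intros. unfold g1, i1, i2. replace (x0 + k - x0) with k by ring. unfold Rdiv. ring. }
  assert (G1l : forall k y, g1 (x0 - k) y =
     - (((u (x0 - k) y - 1) * k + - v (x0 - k) y * (y - y0)) / (k ^ 2 + (y - y0) ^ 2))).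
  { intros. unfold g1, i1, i2. replace (x0 - k - x0) with (- k) by ring.
    replace ((- k) ^ 2) with (k ^ 2) by ring. unfold Rdiv. ring. }
  assert (G2t : forall k x, g2 x (y0 + k) =
     - (((u x (y0 + k) - 1) * k + - v x (y0 + k) * (x - x0)) / (k ^ 2 + (x - x0) ^ 2))).
  { intros. unfold g2, i1, i2. replace (y0 + k - y0) with k by ring.
    rewrite (Rplus_comm ((x - x0) ^ 2)). unfold Rdiv. ring. }
  assert (G2b : forall k x, g2 x (y0 - k) =
     ((u x (y0 - k) - 1) * k + v x (y0 - k) * (x - x0)) / (k ^ 2 + (x - x0) ^ 2)).
  { intros. unfold g2, i1, i2. replace (y0 - k - y0) with (- k) by ring.
    replace ((- k) ^ 2) with (k ^ 2) by ring.
    rewrite (Rplus_comm ((x - x0) ^ 2)). unfold Rdiv. ring. }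
  assert (EX : forall k, 0 < k <= s ->
     ex_RInt (fun y => g1 (x0 + k) y - g1 (x0 - k) y) (y0 - k) (y0 + k) /\
     ex_RInt (fun x => g2 x (y0 + k) - g2 x (y0 - k)) (x0 - k) (x0 + k)).
  { intros k Hk.
    assert (EC : forall a, a <> x0 -> x0 - s <= a <= x0 + s ->
      ex_RInt (fun y => g1 a y) (y0 - k) (y0 + k)).
    { intros a N Ha. apply (ex_RInt_continuous (V := R_CompleteNormedModule)).
      intros z. rewrite Rmin_left, Rmax_right by lra. intros hz.
      apply continuity_2d_pt_r, Hg; [apply HQ; lra|congruence]. }
    assert (ER : forall a, a <> y0 -> y0 - s <= a <= y0 + s ->
      ex_RInt (fun x => g2 x a) (x0 - k) (x0 + k)).
    { intros a N Ha. apply (ex_RInt_continuous (V := R_CompleteNormedModule)).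
      intros z. rewrite Rmin_left, Rmax_right by lra. intros hz.
      apply continuity_2d_pt_l, Hg; [apply HQ; lra|congruence]. }
    split; apply (ex_RInt_minus (V := R_NormedModule)); first [apply EC; lra | apply ER; lra]. }
  assert (SB : forall k w, 0 < k -> - k <= w <= k ->
     square_boundary x0 y0 k (x0 + k) (y0 + w) /\ square_boundary x0 y0 k (x0 - k) (y0 + w) /\
     square_boundary x0 y0 k (x0 + w) (y0 + k) /\ square_boundary x0 y0 k (x0 + w) (y0 - k)).
  { intros k w Hk Hw. unfold square_boundary.
    replace (x0 + k - x0) with k by ring. replace (x0 - k - x0) with (- k) by ring.
    replace (y0 + k - y0) with k by ring. replace (y0 - k - y0) with (- k) by ring.
    replace (x0 + w - x0) with w by ring. replace (y0 + w - y0) with w by ring.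
    rewrite Rabs_Ropp, (Rabs_pos_eq k) by lra.
    assert (Rabs w <= k) by now apply Rabs_le_between. repeat split; auto; lra. }
  assert (Side : forall k l m, 0 < k -> l <= 0 -> l <= m ->
     (forall x y, square_boundary x0 y0 k x y -> l <= u x y - 1 - Rabs (v x y) /\
        u x y - 1 + Rabs (v x y) <= m) ->
     let M := Rmax (m / 2 * / k) (m * / k) in
     (forall y, y0 - k <= y <= y0 + k ->
        2 * (l * / k) <= g1 (x0 + k) y - g1 (x0 - k) y <= 2 * M) /\
     (forall x, x0 - k <= x <= x0 + k ->
        - (2 * M) <= g2 x (y0 + k) - g2 x (y0 - k) <= - (2 * (l * / k)))).
  { intros k l m Hk l0 lm Hb M.
    assert (KM : forall w A B, - k <= w <= k -> l <= A - Rabs B -> A + Rabs B <= m ->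
      l * / k <= (A * k + B * w) / (k ^ 2 + w ^ 2) <= M).
    { intros w A B Hw h1 h2. destruct (K k w A B l m Hk Hw h1 h2 l0 lm) as (k1 & k2 & k3).
      split; auto. unfold M. destruct (Rle_or_lt m 0).
      - eapply Rle_trans; [apply k2; auto|apply Rmax_l].
      - eapply Rle_trans; [apply k3; lra|apply Rmax_r]. }
    split.
    - intros y Hy. destruct (SB k (y - y0) Hk ltac:(lra)) as (b1 & b2 & _).
      replace (y0 + (y - y0)) with y in b1, b2 by ring.
      destruct (Hb _ _ b1) as [c1 c2], (Hb _ _ b2) as [c3 c4].
      pose proof (KM (y - y0) _ _ ltac:(lra) c1 c2) as d1.
      rewrite <- (Rabs_Ropp (v (x0 - k) y)) in c3, c4.
      pose proof (KM (y - y0) _ _ ltac:(lra) c3 c4) as d2.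
      rewrite G1r, G1l. lra.
    - intros x Hx. destruct (SB k (x - x0) Hk ltac:(lra)) as (_ & _ & b1 & b2).
      replace (x0 + (x - x0)) with x in b1, b2 by ring.
      destruct (Hb _ _ b1) as [c1 c2], (Hb _ _ b2) as [c3 c4].
      rewrite <- (Rabs_Ropp (v x (y0 + k))) in c1, c2.
      pose proof (KM (x - x0) _ _ ltac:(lra) c1 c2) as d1.
      pose proof (KM (x - x0) _ _ ltac:(lra) c3 c4) as d2.
      rewrite G2t, G2b. lra. }
  (* With [|u|] and [|v|] at most [1 / 8], the quantities [u - 1 - |v|] and [u - 1 + |v|] lie
     between [- 5 / 4] and [- 3 / 4]. *)
  destruct (Side s (- (5 / 4)) (- (3 / 4)) Hs ltac:(lra) ltac:(lra)) as [S1 S2].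
  { intros x y b. destruct (HB x y b) as [h1 h2]. apply Rabs_le_between in h1. lra. }
  destruct (Side t (- (1 / 8)) (1 / 8) ltac:(lra) ltac:(lra) ltac:(lra)) as [T1 T2].
  { intros x y (b1 & b2 & _). specialize (H1 x y ltac:(simpl; lra) ltac:(simpl; lra)).
    specialize (H2 x y ltac:(simpl; lra) ltac:(simpl; lra)). simpl in H1, H2.
    rewrite Rminus_0_r in H2. apply Rabs_lt_between in H1. lra. }
  assert (Is : 0 < / s) by now apply Rinv_0_lt_compat.
  assert (It : 0 < / t) by now apply Rinv_0_lt_compat.
  rewrite Rmax_left in S1, S2 by lra. rewrite Rmax_right in T1, T2 by lra.
  destruct (EX s ltac:(lra)) as [X1 X2]. destruct (EX t ltac:(lra)) as [X3 X4].
  (* The circulation is at most [- 13 / 2 + 7 / 2 = - 3] around the large square and at least [- 1]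
     around the small one, yet the two are equal. *)
  pose proof (circ_bound_ex g1 g2 (x0 - s) (x0 + s) (y0 - s) (y0 + s)
    (- (13 / 8) * / s) (7 / 8 * / s) (13 / 8 * / s) (7 / 8 * / s) ltac:(lra) ltac:(lra) X1 X2
    ltac:(intros y Hy; specialize (S1 y Hy); apply Rabs_le_between; lra)
    ltac:(intros x Hx; specialize (S2 x Hx); apply Rabs_le_between; lra)) as B1.
  pose proof (circ_bound_ex g1 g2 (x0 - t) (x0 + t) (y0 - t) (y0 + t)
    0 (1 / 4 * / t) 0 (1 / 4 * / t) ltac:(lra) ltac:(lra) X3 X4
    ltac:(intros y Hy; specialize (T1 y Hy); apply Rabs_le_between; lra)
    ltac:(intros x Hx; specialize (T2 x Hx); apply Rabs_le_between; lra)) as B2.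
  rewrite <- E in B2. apply Rabs_le_between in B1, B2.
  replace (y0 + s - (y0 - s)) with (2 * s) in B1 by ring.
  replace (x0 + s - (x0 - s)) with (2 * s) in B1 by ring.
  replace (y0 + t - (y0 - t)) with (2 * t) in B2 by ring.
  replace (x0 + t - (x0 - t)) with (2 * t) in B2 by ring.
  assert (N1 : forall c, c * / s * (2 * s) = 2 * c) by (intros; field; lra).
  assert (N2 : forall c, c * / t * (2 * t) = 2 * c) by (intros; field; lra).
  rewrite !N1 in B1. rewrite !N2 in B2. lra.
Qed.

(* Apply the previous lemma to [exp (n (f - f(z0)))] for [n] large. *)
Lemma holo_re_square_max u v (U : R -> R -> Prop) x0 y0 s eta :
  open2 U -> (forall x y, U x y -> holo u v x y) -> 0 < s ->
  (forall x y, x0 - s <= x <= x0 + s -> y0 - s <= y <= y0 + s -> U x y) -> 0 < eta ->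
  ~ (forall x y, square_boundary x0 y0 s x y -> u x y <= u x0 y0 - eta).
Proof.
  intros HU Hf Hs HQ He HB.
  (* On the boundary the modulus drops to at most [exp (- 8) <= 1 / 9]. The zero terms in [u1] and
     [v1] display the product with the constant [n + 0 i]. *)
  set (n := 8 / eta).
  set (u1 := fun x y => n * (u x y + - u x0 y0) - 0 * (v x y + - v x0 y0)).
  set (v1 := fun x y => n * (v x y + - v x0 y0) + 0 * (u x y + - u x0 y0)).
  assert (Hn : n * eta = 8) by (unfold n; field; lra).
  apply (holo_center_small_boundary (fun x y => exp (u1 x y) * cos (v1 x y))
    (fun x y => exp (u1 x y) * sin (v1 x y)) U x0 y0 s); auto.
  - intros x y k. apply holo_exp.
    apply (holo_mult (fun _ _ => n) (fun _ _ => 0) (fun x y => u x y + - u x0 y0)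
      (fun x y => v x y + - v x0 y0)); [apply holo_const|].
    apply holo_plus; [auto|apply holo_const].
  - unfold u1, v1. rewrite !Rplus_opp_r, !Rmult_0_r, Rminus_0_r, Rplus_0_r, exp_0, cos_0. ring.
  - unfold u1, v1. rewrite !Rplus_opp_r, !Rmult_0_r, Rminus_0_r, Rplus_0_r, exp_0, sin_0. ring.
  - intros x y b. specialize (HB x y b).
    assert (0 < n) by (unfold n; apply Rdiv_lt_0_compat; lra).
    assert (Hx : exp (u1 x y) <= 1 / 8).
    { assert (u1 x y <= Ropp 8) by (unfold u1; nra).
      pose proof (exp_ineq1_le 8).
      apply Rle_trans with (exp (Ropp 8)).
      { destruct H0 as [H0|H0]; [left; now apply exp_increasing|rewrite H0; right; auto]. }
      rewrite exp_Ropp. replace (1 / 8) with (/ 8) by lra.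
      apply Rinv_le_contravar; lra. }
    pose proof (exp_pos (u1 x y)). pose proof (COS_bound (v1 x y)). pose proof (SIN_bound (v1 x y)).
    split; rewrite Rabs_mult, (Rabs_pos_eq (exp _)) by lra.
    + apply Rle_trans with (exp (u1 x y) * 1); [|lra].
      apply Rmult_le_compat_l; [lra|]. apply Rabs_le_between; lra.
    + apply Rle_trans with (exp (u1 x y) * 1); [|lra].
      apply Rmult_le_compat_l; [lra|]. apply Rabs_le_between; lra.
Qed.

Lemma closed2_and (E F : R -> R -> Prop) :
  closed2 E -> closed2 F -> closed2 (fun x y => E x y /\ F x y).
Proof.
  intros HE HF x y N. apply not_and_or in N.
  destruct N as [N|N]; [destruct (HE x y N) as [r [Hr H]]|destruct (HF x y N) as [r [Hr H]]];
    exists r; split; auto; intros x' y' h1 h2 [k1 k2]; now apply (H x' y').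
Qed.

Lemma closed2_or (E F : R -> R -> Prop) :
  closed2 E -> closed2 F -> closed2 (fun x y => E x y \/ F x y).
Proof.
  intros HE HF x y N. apply not_or_and in N. destruct N as [N1 N2].
  destruct (HE x y N1) as [r [Hr H]]. destruct (HF x y N2) as [s [Hs G]].
  exists (Rmin r s). split; [now apply Rmin_pos|]. intros x' y' h1 h2.
  pose proof (Rmin_l r s). pose proof (Rmin_r r s).
  intros [k|k]; [apply (H x' y')|apply (G x' y')]; auto; lra.
Qed.

Lemma closed2_le (f g : R -> R -> R) :
  (forall x y, continuity_2d_pt f x y) -> (forall x y, continuity_2d_pt g x y) ->
  closed2 (fun x y => f x y <= g x y).
Proof.
  intros Hf Hg x y N. apply Rnot_le_lt in N.
  destruct (continuity_2d_pt_minus _ _ _ _ (Hf x y) (Hg x y)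
    (mkposreal _ (proj2 (Rlt_0_minus _ _) N))) as [r Hr]. simpl in Hr.
  exists r. split; [apply cond_pos|]. intros x' y' h1 h2. specialize (Hr x' y' h1 h2).
  apply Rabs_lt_between in Hr. lra.
Qed.

Lemma closed2_square_boundary x0 y0 s : closed2 (square_boundary x0 y0 s).
Proof.
  assert (C1 : forall x y, continuity_2d_pt (fun x _ => Rabs (x - x0)) x y).
  { intros. apply (continuity_1d_2d_pt_comp Rabs); [apply Rcontinuity_abs|].
    apply continuity_2d_pt_minus; [apply continuity_2d_pt_id1|apply continuity_2d_pt_const]. }
  assert (C2 : forall x y, continuity_2d_pt (fun _ y => Rabs (y - y0)) x y).
  { intros. apply (continuity_1d_2d_pt_comp Rabs); [apply Rcontinuity_abs|].
    apply continuity_2d_pt_minus; [apply continuity_2d_pt_id2|apply continuity_2d_pt_const]. }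
  assert (C3 : forall x y, continuity_2d_pt (fun _ _ => s) x y)
    by (intros; apply continuity_2d_pt_const).
  assert (H : closed2 (fun x y => Rabs (x - x0) <= s /\ Rabs (y - y0) <= s /\
     (s <= Rabs (x - x0) \/ s <= Rabs (y - y0)))).
  { apply closed2_and; [|apply closed2_and; [|apply closed2_or]]; apply closed2_le; auto. }
  intros x y N. destruct (H x y) as [r [Hr G]].
  { unfold square_boundary in N. lra. }
  exists r; split; auto. intros x' y' h1 h2 (k1 & k2 & k3). apply (G x' y' h1 h2). lra.
Qed.

Lemma square_boundary_max (K : R -> R -> Prop) (F : R -> R -> R) x0 y0 s :
  closed2 K ->
  (forall x y, Rabs (x - x0) <= s -> Rabs (y - y0) <= s -> continuity_2d_pt F x y) ->
  (exists x y, square_boundary x0 y0 s x y /\ K x y) ->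
  exists x y, (square_boundary x0 y0 s x y /\ K x y) /\
    forall x' y', square_boundary x0 y0 s x' y' -> K x' y' -> F x' y' <= F x y.
Proof.
  intros HK HF Hex.
  destruct (closed_max (x0 - s) (x0 + s) (y0 - s) (y0 + s)
    (fun x y => square_boundary x0 y0 s x y /\ K x y) F) as (x & y & H & M); auto.
  - intros x y [(h1 & h2 & _) _]. apply Rabs_le_between in h1, h2. lra.
  - apply closed2_and; auto using closed2_square_boundary.
  - intros x y [(h1 & h2 & _) _] e He. destruct (HF x y h1 h2 (mkposreal e He)) as [r Hr].
    exists r. split; [apply cond_pos|]. intros x' y' _ g1 g2. specialize (Hr x' y' g1 g2).
    simpl in Hr. apply Rabs_lt_between in Hr. lra.
  - exists x, y. auto.
Qed.

(* The perturbation by [Re ((z - z0) conj z0)] makes the maximum over the square strict: the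
   points of [{U = m}] all lie in the disc centred at the origin with [z0] on its boundary. *)
Lemma holo_no_farthest_max u v (U : R -> R -> Prop) x0 y0 :
  open2 U -> (forall x y, U x y -> holo u v x y) -> U x0 y0 ->
  ~ (forall x y, U x y -> u x y <= u x0 y0 /\ (u x y = u x0 y0 -> x ^ 2 + y ^ 2 <= x0 ^ 2 + y0 ^ 2)).
Proof.
  intros HU Hf U0 HM.
  destruct (HU x0 y0 U0) as [r [Hr HB]].
  set (s := r / 2).
  assert (HQ : forall x y, Rabs (x - x0) <= s -> Rabs (y - y0) <= s -> U x y)
    by (intros; apply HB; unfold s in *; lra).
  assert (Hs : 0 < s) by (unfold s; lra).
  set (l := fun x y => (x + - x0) * x0 - (y + - y0) * - y0).
  set (l' := fun x y => (x + - x0) * - y0 + (y + - y0) * x0).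
  assert (Hl : forall x y, holo l l' x y).
  { intros. apply (holo_mult (fun x _ => x + - x0) (fun _ y => y + - y0) (fun _ _ => x0) (fun _ _ => - y0)).
    - apply (holo_plus (fun x _ => x) (fun _ y => y)); [apply holo_id|apply holo_const].
    - apply holo_const. }
  assert (Cl : forall x y, continuity_2d_pt l x y) by (intros; apply Hl).
  assert (Cu : forall x y, Rabs (x - x0) <= s -> Rabs (y - y0) <= s -> continuity_2d_pt u x y)
    by (intros x y h1 h2; apply (Hf x y (HQ x y h1 h2))).
  (* Compactness turns the strict inequality on the part of the boundary with [l >= 0] into a
     positive gap. *)
  destruct (square_boundary_max (fun x y => 0 <= l x y) u x0 y0 s) as (x1 & y1 & [B1 L1] & M1); auto.
  { apply closed2_le; auto. intros; apply continuity_2d_pt_const. }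
  { destruct (Rle_or_lt 0 x0).
    - exists (x0 + s), y0. unfold square_boundary, l.
      replace (x0 + s - x0) with s by ring. rewrite Rminus_diag, Rabs_R0, Rabs_pos_eq by lra.
      split; [lra|nra].
    - exists (x0 - s), y0. unfold square_boundary, l.
      replace (x0 - s - x0) with (- s) by ring. rewrite Rminus_diag, Rabs_R0, Rabs_Ropp, Rabs_pos_eq by lra.
      split; [lra|nra]. }
  (* As [|z|^2 = |z0|^2 + 2 l + |z - z0|^2], a boundary point with [l >= 0] is farther from the
     origin than [z0], so it cannot attain the maximum. *)
  assert (Far : forall x y, square_boundary x0 y0 s x y -> 0 <= l x y -> u x y < u x0 y0).
  { intros x y (h1 & h2 & h3) hl. destruct (HM x y (HQ x y h1 h2)) as [g1 g2].
    destruct g1 as [g1|g1]; auto. exfalso. specialize (g2 g1).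
    assert (0 < (x - x0) ^ 2 + (y - y0) ^ 2).
    { pose proof (pow2_ge_0 (x - x0)). pose proof (pow2_ge_0 (y - y0)).
      destruct h3 as [h3|h3]; rewrite <- h3 in Hs.
      - assert (x - x0 <> 0) by (intros Z; rewrite Z, Rabs_R0 in Hs; lra).
        pose proof (pow2_gt_0 _ H1). lra.
      - assert (y - y0 <> 0) by (intros Z; rewrite Z, Rabs_R0 in Hs; lra).
        pose proof (pow2_gt_0 _ H1). lra. }
    unfold l in hl. nra. }
  pose proof (Far x1 y1 B1 L1) as Hgap.
  set (gap := u x0 y0 - u x1 y1).
  set (Z := s * (Rabs x0 + Rabs y0) + 1).
  assert (HZ : 0 < Z).
  { unfold Z. pose proof (Rabs_pos x0). pose proof (Rabs_pos y0). nra. }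
  assert (lZ : forall x y, Rabs (x - x0) <= s -> Rabs (y - y0) <= s -> l x y < Z).
  { intros x y h1 h2. unfold l, Z.
    replace ((x + - x0) * x0 - (y + - y0) * - y0) with ((x - x0) * x0 + (y - y0) * y0) by ring.
    pose proof (Rle_abs ((x - x0) * x0)). pose proof (Rle_abs ((y - y0) * y0)).
    rewrite Rabs_mult in *.
    pose proof (Rmult_le_compat_r (Rabs x0) _ _ (Rabs_pos x0) h1).
    pose proof (Rmult_le_compat_r (Rabs y0) _ _ (Rabs_pos y0) h2). lra. }
  (* Since [l < Z] on the square, adding [tau * l] costs less than the gap where [l >= 0], and it
     lowers the value where [l < 0]. *)
  set (tau := gap / Z).
  assert (Ht : 0 < tau) by (apply Rdiv_lt_0_compat; unfold gap; lra).
  assert (HtZ : tau * Z = gap) by (unfold tau; field; lra).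
  set (u' := fun x y => u x y + (l x y * tau - l' x y * 0)).
  set (v' := fun x y => v x y + (l x y * 0 + l' x y * tau)).
  assert (Hf' : forall x y, U x y -> holo u' v' x y).
  { intros x y k. apply holo_plus; auto. apply (holo_mult l l' (fun _ _ => tau) (fun _ _ => 0)); auto.
    apply holo_const. }
  assert (E0 : u' x0 y0 = u x0 y0) by (unfold u', l; ring).
  assert (Lt : forall x y, square_boundary x0 y0 s x y -> u' x y < u x0 y0).
  { intros x y b. pose proof b as (h1 & h2 & _). unfold u'. rewrite Rmult_0_r, Rminus_0_r.
    destruct (Rle_or_lt 0 (l x y)) as [hl|hl].
    - specialize (M1 x y b hl). specialize (lZ x y h1 h2).
      assert (l x y * tau < gap) by nra. unfold gap in *. lra.
    - assert (l x y * tau < 0) by (clear - hl Ht; nra).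
      destruct (HM x y (HQ x y h1 h2)) as [h3 _]. lra. }
  destruct (square_boundary_max (fun _ _ => True) u' x0 y0 s) as (x2 & y2 & [B2 _] & M2).
  { intros x y N. tauto. }
  { intros x y h1 h2. apply (Hf' x y (HQ x y h1 h2)). }
  { exists x1, y1. auto. }
  specialize (Lt x2 y2 B2).
  apply (holo_re_square_max u' v' U x0 y0 s (u x0 y0 - u' x2 y2)); auto; try lra.
  - intros x y hx hy. apply HQ; apply Rabs_le_between; lra.
  - intros x y b. specialize (M2 x y b I). lra.
Qed.

(** The half-angle form of the argument works on the whole plane slit along the closed negative
    axis, which is what the positivity hypothesis expresses; [atan (g / f)] would fail where [f]
    vanishes. *)
Lemma derivable_pt_lim_arg f g s f' g' :
  derivable_pt_lim f s f' -> derivable_pt_lim g s g' ->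
  0 < sqrt (f s ^ 2 + g s ^ 2) + f s ->
  derivable_pt_lim (fun t => 2 * atan (g t / (sqrt (f t ^ 2 + g t ^ 2) + f t))) s
    ((f s * g' - g s * f') / (f s ^ 2 + g s ^ 2)).
Proof.
  intros Hf Hg Hp. apply is_derive_Reals in Hf, Hg. apply is_derive_Reals.
  assert (HD : 0 < f s ^ 2 + g s ^ 2).
  { pose proof (pow2_ge_0 (f s)). pose proof (pow2_ge_0 (g s)).
    destruct (Req_dec (f s ^ 2 + g s ^ 2) 0) as [Z|Z]; [|lra].
    rewrite Z, sqrt_0 in Hp. nra. }
  auto_derive.
  - change (f s * (f s * 1)) with (f s ^ 2). change (g s * (g s * 1)) with (g s ^ 2).
    repeat split; try (eexists; eassumption); lra.
  - assert (Df : Derive (fun x : R => f x) s = f') by now apply is_derive_unique.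
    assert (Dg : Derive (fun x : R => g x) s = g') by now apply is_derive_unique.
    rewrite Df, Dg.
    change (f s * (f s * 1)) with (f s ^ 2). change (g s * (g s * 1)) with (g s ^ 2).
    set (p := sqrt (f s ^ 2 + g s ^ 2)) in *.
    assert (Ep : p * p = f s ^ 2 + g s ^ 2) by (apply sqrt_sqrt; lra).
    assert (Np : p <> 0) by (intros Z; rewrite Z in Ep; lra).
    assert (Nw : p + f s <> 0) by lra.
    rewrite <- Ep. set (a := f s) in *. set (b := g s) in *.
    assert (Eb : b ^ 2 = p * p - a ^ 2) by lra.
    (* This is [1 + tan^2] of the half angle. *)
    assert (Q : 1 + b * / (p + a) * (b * / (p + a) * 1) = 2 * p / (p + a)).
    { replace (1 + b * / (p + a) * (b * / (p + a) * 1)) with (((p + a) ^ 2 + b ^ 2) / (p + a) ^ 2)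
        by (field; auto). rewrite Eb. field. auto. }
    rewrite Q. field_simplify_eq; [ring [Eb]|auto].
Qed.

(** * The Phragmen-Lindelof theorem in a plane sector *)

Definition rotX (zeta x y : R) : R := x * cos zeta + y * sin zeta.
Definition rotY (zeta x y : R) : R := y * cos zeta - x * sin zeta.

(* The branch of [arg (x + i y) - zeta] with values in (-PI, PI), by the half-angle formula. *)
Definition arg (zeta x y : R) : R :=
  2 * atan (rotY zeta x y / (sqrt (rotX zeta x y ^ 2 + rotY zeta x y ^ 2) + rotX zeta x y)).

Lemma rot_norm zeta x y : rotX zeta x y ^ 2 + rotY zeta x y ^ 2 = x ^ 2 + y ^ 2.
Proof. unfold rotX, rotY. pose proof (sin2_cos2 zeta) as H. unfold Rsqr in H.
  assert (Hs : sin zeta ^ 2 = 1 - cos zeta ^ 2) by lra. ring [Hs].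
Qed.

Lemma rot_polar zeta r t :
  rotX zeta (r * cos (zeta + t)) (r * sin (zeta + t)) = r * cos t /\
  rotY zeta (r * cos (zeta + t)) (r * sin (zeta + t)) = r * sin t.
Proof.
  unfold rotX, rotY. rewrite cos_plus, sin_plus. pose proof (sin2_cos2 zeta) as H. unfold Rsqr in H.
  assert (Hs : sin zeta ^ 2 = 1 - cos zeta ^ 2) by lra. split; ring [Hs].
Qed.

Lemma polar_norm r t : (r * cos t) ^ 2 + (r * sin t) ^ 2 = r ^ 2.
Proof. pose proof (sin2_cos2 t) as H. unfold Rsqr in H.
  assert (Hs : sin t ^ 2 = 1 - cos t ^ 2) by lra. ring [Hs].
Qed.

Lemma one_plus_cos_pos t : Rabs t < PI -> 0 < 1 + cos t.
Proof.
  intros H. apply Rabs_lt_between in H.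
  replace t with (2 * (t / 2)) by field. rewrite cos_2a_cos.
  assert (0 < cos (t / 2)) by (apply cos_gt_0; lra). nra.
Qed.

Lemma polar_slit zeta r t : 0 < r -> Rabs t < PI ->
  0 < sqrt (rotX zeta (r * cos (zeta + t)) (r * sin (zeta + t)) ^ 2 +
            rotY zeta (r * cos (zeta + t)) (r * sin (zeta + t)) ^ 2) +
      rotX zeta (r * cos (zeta + t)) (r * sin (zeta + t)).
Proof.
  intros Hr Ht. destruct (rot_polar zeta r t) as [-> ->].
  rewrite polar_norm, sqrt_pow2 by lra. pose proof (one_plus_cos_pos t Ht). nra.
Qed.

Lemma arg_polar zeta r t : 0 < r -> Rabs t < PI ->
  arg zeta (r * cos (zeta + t)) (r * sin (zeta + t)) = t.
Proof.
  intros Hr Ht. unfold arg. destruct (rot_polar zeta r t) as [-> ->].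
  rewrite polar_norm, sqrt_pow2 by lra. pose proof (one_plus_cos_pos t Ht).
  apply Rabs_lt_between in Ht.
  replace (r * sin t / (r + r * cos t)) with (tan (t / 2)).
  { rewrite atan_tan by lra. field. }
  assert (0 < cos (t / 2)) by (apply cos_gt_0; lra).
  replace (sin t) with (2 * sin (t / 2) * cos (t / 2)) by (rewrite <- sin_2a; f_equal; field).
  replace (cos t) with (2 * cos (t / 2) * cos (t / 2) - 1) by (rewrite <- cos_2a_cos; f_equal; field).
  unfold tan. field. split; [|lra].
  pose proof (Rmult_lt_0_compat _ _ Hr (Rmult_lt_0_compat _ _ H0 H0)) as P. lra.
Qed.

Lemma continuity_2d_pt_pow2 f x y : continuity_2d_pt f x y -> continuity_2d_pt (fun x y => f x y ^ 2) x y.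
Proof.
  intros H. apply (continuity_2d_pt_ext (fun x y => f x y * f x y)); [intros; ring|].
  now apply continuity_2d_pt_mult.
Qed.

(** The components of [log (z e^{- i zeta})]: rotation does not affect the modulus, and the
    derivative is still [1 / z]. *)
Lemma holo_log zeta x y :
  0 < sqrt (rotX zeta x y ^ 2 + rotY zeta x y ^ 2) + rotX zeta x y ->
  holo (fun x y => ln (x ^ 2 + y ^ 2) / 2) (arg zeta) x y.
Proof.
  intros Hp. pose proof (rot_norm zeta x y) as EN.
  assert (HD : 0 < x ^ 2 + y ^ 2).
  { destruct (Req_dec (x ^ 2 + y ^ 2) 0) as [Z|Z];
      [|pose proof (pow2_ge_0 x); pose proof (pow2_ge_0 y); lra].
    rewrite EN, Z, sqrt_0 in Hp. pose proof (pow2_ge_0 (rotY zeta x y)). nra. }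
  assert (CX : continuity_2d_pt (rotX zeta) x y).
  { apply continuity_2d_pt_plus; apply continuity_2d_pt_mult;
      auto using continuity_2d_pt_const, continuity_2d_pt_id1, continuity_2d_pt_id2. }
  assert (CY : continuity_2d_pt (rotY zeta) x y).
  { apply continuity_2d_pt_minus; apply continuity_2d_pt_mult;
      auto using continuity_2d_pt_const, continuity_2d_pt_id1, continuity_2d_pt_id2. }
  split; [|split].
  - apply continuity_2d_pt_mult; [|apply continuity_2d_pt_const].
    apply (continuity_1d_2d_pt_comp ln (fun x y => x ^ 2 + y ^ 2)).
    + apply derivable_continuous_pt. exists (/ (x ^ 2 + y ^ 2)). now apply derivable_pt_lim_ln.
    + apply continuity_2d_pt_plus; apply continuity_2d_pt_pow2;
        [apply continuity_2d_pt_id1|apply continuity_2d_pt_id2].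
  - apply continuity_2d_pt_mult; [apply continuity_2d_pt_const|].
    apply (continuity_1d_2d_pt_comp atan); [apply derivable_continuous_pt, derivable_pt_atan|].
    apply continuity_2d_pt_mult; auto. apply continuity_2d_pt_inv; [|lra].
    apply continuity_2d_pt_plus; auto.
    apply (continuity_1d_2d_pt_comp sqrt (fun x y => rotX zeta x y ^ 2 + rotY zeta x y ^ 2)).
    + apply continuity_pt_sqrt. lra.
    + apply continuity_2d_pt_plus; now apply continuity_2d_pt_pow2.
  - exists (x / (x ^ 2 + y ^ 2)), (- y / (x ^ 2 + y ^ 2)).
    assert (R1 : rotX zeta x y * cos zeta - rotY zeta x y * sin zeta = x).
    { unfold rotX, rotY. pose proof (sin2_cos2 zeta) as H. unfold Rsqr in H.
      assert (Hs : sin zeta ^ 2 = 1 - cos zeta ^ 2) by lra. ring [Hs]. }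
    assert (R2 : rotX zeta x y * - sin zeta - rotY zeta x y * cos zeta = - y).
    { unfold rotX, rotY. pose proof (sin2_cos2 zeta) as H. unfold Rsqr in H.
      assert (Hs : sin zeta ^ 2 = 1 - cos zeta ^ 2) by lra. ring [Hs]. }
    repeat split.
    + apply is_derive_Reals. auto_derive;
        [|change (x * (x * 1)) with (x ^ 2); change (y * (y * 1)) with (y ^ 2); field]; lra.
    + apply is_derive_Reals. auto_derive;
        [|change (x * (x * 1)) with (x ^ 2); change (y * (y * 1)) with (y ^ 2); field]; lra.
    + rewrite <- R2, <- EN.
      apply (derivable_pt_lim_arg (fun s => rotX zeta s y) (fun s => rotY zeta s y)); auto;
        unfold rotX, rotY; apply is_derive_Reals; auto_derive; auto; ring.
    + replace (x / (x ^ 2 + y ^ 2)) with ((rotX zeta x y * cos zeta - rotY zeta x y * sin zeta) /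
        (rotX zeta x y ^ 2 + rotY zeta x y ^ 2)) by now rewrite R1, EN.
      apply (derivable_pt_lim_arg (fun s => rotX zeta x s) (fun s => rotY zeta x s)); auto;
        unfold rotX, rotY; apply is_derive_Reals; auto_derive; auto; ring.
Qed.

(* [w1 + i w2] is [exp (- del (z e^{- i zeta})^bet)] on the slit plane. *)
Lemma holo_barrier zeta del bet : exists w1 w2 : R -> R -> R,
  forall r t, 0 < r -> Rabs t < PI ->
    holo w1 w2 (r * cos (zeta + t)) (r * sin (zeta + t)) /\
    w1 (r * cos (zeta + t)) (r * sin (zeta + t)) =
      exp (- del * (exp (bet * ln r) * cos (bet * t))) * cos (- del * (exp (bet * ln r) * sin (bet * t))) /\
    w2 (r * cos (zeta + t)) (r * sin (zeta + t)) =
      exp (- del * (exp (bet * ln r) * cos (bet * t))) * sin (- del * (exp (bet * ln r) * sin (bet * t))).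
Proof.
  (* From the inside out: [L1 + i L2] is [bet] times the logarithm, [E1 + i E2] the power, and
     [D1 + i D2] the power times [- del]. *)
  set (L := fun x y => ln (x ^ 2 + y ^ 2) / 2).
  set (L1 := fun x y => bet * L x y - 0 * arg zeta x y).
  set (L2 := fun x y => bet * arg zeta x y + 0 * L x y).
  set (E1 := fun x y => exp (L1 x y) * cos (L2 x y)).
  set (E2 := fun x y => exp (L1 x y) * sin (L2 x y)).
  set (D1 := fun x y => - del * E1 x y - 0 * E2 x y).
  set (D2 := fun x y => - del * E2 x y + 0 * E1 x y).
  exists (fun x y => exp (D1 x y) * cos (D2 x y)), (fun x y => exp (D1 x y) * sin (D2 x y)).
  intros r t Hr Ht. split.
  - apply holo_exp. apply (holo_mult (fun _ _ => - del) (fun _ _ => 0) E1 E2); [apply holo_const|].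
    apply holo_exp. apply (holo_mult (fun _ _ => bet) (fun _ _ => 0) L (arg zeta)); [apply holo_const|].
    apply holo_log. now apply polar_slit.
  - assert (HL : L (r * cos (zeta + t)) (r * sin (zeta + t)) = ln r).
    { unfold L. rewrite polar_norm. replace (r ^ 2) with (r * r) by ring.
      rewrite ln_mult by auto. field. }
    unfold D1, D2, E1, E2, L1, L2. rewrite HL, arg_polar by auto.
    rewrite !Rmult_0_l, !Rminus_0_r, !Rplus_0_r. auto.
Qed.

Definition cmod (a b : R) : R := sqrt (a ^ 2 + b ^ 2).

Lemma cmod_pos a b : 0 <= cmod a b.
Proof. apply sqrt_pos. Qed.

Lemma re_rotated_le u v s m : 0 <= m -> u * (m * cos s) - v * (m * sin s) <= cmod u v * m.
Proof.
  intros Hm. replace (u * (m * cos s) - v * (m * sin s)) with ((u * cos s - v * sin s) * m) by ring.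
  apply Rmult_le_compat_r; auto. unfold cmod.
  apply Rle_trans with (Rabs (u * cos s - v * sin s)); [apply Rle_abs|].
  rewrite <- sqrt_Rsqr_abs. apply sqrt_le_1_alt. unfold Rsqr.
  pose proof (sin2_cos2 s) as H. unfold Rsqr in H.
  pose proof (pow2_ge_0 (u * sin s + v * cos s)).
  replace (u ^ 2 + v ^ 2) with ((u ^ 2 + v ^ 2) * (sin s * sin s + cos s * cos s)) by (rewrite H; ring).
  nra.
Qed.

Lemma exp_damping sigma bet k m B : 0 < sigma -> sigma < bet -> 0 < k -> 0 < m -> 0 <= B ->
  exists R1, 1 < R1 /\ forall r, R1 < r -> B * exp (exp (sigma * ln r)) * exp (- (k * exp (bet * ln r))) < m.
Proof.
  intros Hs Hb Hk Hm HB.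
  (* Beyond the first summand [exp (sigma * l)] is at most half of [k * exp (bet * l)]; beyond the
     second the remaining half [z] exceeds [B / m], so that [B / exp z < m]. *)
  set (l0 := 2 / (k * (bet - sigma)) + 2 * B / (m * k * bet)).
  assert (P1 : 0 < 2 / (k * (bet - sigma))) by (apply Rdiv_lt_0_compat; nra).
  assert (P2 : 0 <= 2 * B / (m * k * bet)).
  { apply Rmult_le_pos; [lra|]. left. apply Rinv_0_lt_compat.
    apply Rmult_lt_0_compat; [nra|lra]. }
  exists (exp l0). split.
  { rewrite <- exp_0. apply exp_increasing. unfold l0. lra. }
  intros r Hr. assert (Hr0 : 0 < r) by (pose proof (exp_pos l0); lra).
  assert (Hl : l0 < ln r). { rewrite <- (ln_exp l0). apply ln_increasing; auto. apply exp_pos. }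
  set (l := ln r) in *.
  assert (A1 : 2 / k <= exp ((bet - sigma) * l)).
  { pose proof (exp_ineq1_le ((bet - sigma) * l)).
    assert (2 / k <= (bet - sigma) * l); [|lra].
    replace (2 / k) with ((bet - sigma) * (2 / (k * (bet - sigma)))) by (field; lra).
    apply Rmult_le_compat_l; unfold l0 in Hl; lra. }
  assert (A2 : exp (sigma * l) <= k / 2 * exp (bet * l)).
  { replace (bet * l) with (sigma * l + (bet - sigma) * l) by ring. rewrite exp_plus.
    pose proof (exp_pos (sigma * l)).
    assert (1 <= k / 2 * exp ((bet - sigma) * l)).
    { replace 1 with (k / 2 * (2 / k)) by (field; lra). apply Rmult_le_compat_l; lra. }
    nra. }
  rewrite Rmult_assoc, <- exp_plus.
  set (z := k / 2 * exp (bet * l)) in *.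
  assert (A3 : B / m < z).
  { unfold z. pose proof (exp_ineq1_le (bet * l)).
    assert (B / m <= k / 2 * (bet * l)).
    { replace (B / m) with (k / 2 * (bet * (2 * B / (m * k * bet)))) by (field; lra).
      apply Rmult_le_compat_l; [lra|]. apply Rmult_le_compat_l; unfold l0 in Hl; lra. }
    nra. }
  assert (A4 : exp (exp (sigma * l) + - (k * exp (bet * l))) <= / exp z).
  { rewrite <- exp_Ropp. assert (exp (sigma * l) + - (k * exp (bet * l)) <= - z) as [Q|Q] by (unfold z in *; lra).
    - left. now apply exp_increasing.
    - rewrite Q. lra. }
  pose proof (exp_ineq1_le z). pose proof (exp_pos z).
  apply Rle_lt_trans with (B * / exp z); [apply Rmult_le_compat_l; auto|].
  apply Rmult_lt_reg_r with (exp z); auto. rewrite Rmult_assoc, Rinv_l, Rmult_1_r by lra.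
  assert (B < m * z). { replace B with (m * (B / m)) by (field; lra). apply Rmult_lt_compat_l; lra. }
  nra.
Qed.

(** On the bounding rays of a sector the function is continuous only from within. *)
Definition rel_cont (K : R -> R -> Prop) (F : R -> R -> R) (x y : R) : Prop :=
  forall e, 0 < e -> exists d, 0 < d /\ forall x' y', K x' y' ->
    Rabs (x' - x) < d -> Rabs (y' - y) < d -> Rabs (F x' y' - F x y) < e.

Lemma rel_cont_comp2 (K : R -> R -> Prop) (F G H : R -> R -> R) x y :
  rel_cont K F x y -> rel_cont K G x y -> continuity_2d_pt H (F x y) (G x y) ->
  rel_cont K (fun x y => H (F x y) (G x y)) x y.
Proof.
  intros HF HG HH e He. destruct (HH (mkposreal e He)) as [[d Hd] D]. simpl in D.
  destruct (HF d Hd) as [d1 [P1 D1]]. destruct (HG d Hd) as [d2 [P2 D2]].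
  exists (Rmin d1 d2). split; [now apply Rmin_pos|]. intros x' y' k h1 h2.
  pose proof (Rmin_l d1 d2). pose proof (Rmin_r d1 d2).
  apply D; [apply D1|apply D2]; auto; lra.
Qed.

Lemma rel_cont_continuous K F x y : continuity_2d_pt F x y -> rel_cont K F x y.
Proof.
  intros H e He. destruct (H (mkposreal e He)) as [[d Hd] D]. simpl in D. exists d. auto.
Qed.

Lemma rel_cont_re_mult K u v a b x y :
  rel_cont K u x y -> rel_cont K v x y -> rel_cont K a x y -> rel_cont K b x y ->
  rel_cont K (fun x y => u x y * a x y - v x y * b x y) x y.
Proof.
  intros Hu Hv Ha Hb.
  apply (rel_cont_comp2 K (fun x y => u x y * a x y) (fun x y => v x y * b x y) (fun p q => p - q)).
  - apply (rel_cont_comp2 K u a Rmult); auto.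
    apply continuity_2d_pt_mult; [apply continuity_2d_pt_id1|apply continuity_2d_pt_id2].
  - apply (rel_cont_comp2 K v b Rmult); auto.
    apply continuity_2d_pt_mult; [apply continuity_2d_pt_id1|apply continuity_2d_pt_id2].
  - apply continuity_2d_pt_minus; [apply continuity_2d_pt_id1|apply continuity_2d_pt_id2].
Qed.

Lemma continuity_2d_polar zeta r t :
  continuity_2d_pt (fun r t => r * cos (zeta + t)) r t /\
  continuity_2d_pt (fun r t => r * sin (zeta + t)) r t.
Proof.
  assert (C : forall h, continuity_pt h (zeta + t) -> continuity_2d_pt (fun r t => r * h (zeta + t)) r t).
  { intros h Hh. apply continuity_2d_pt_mult; [apply continuity_2d_pt_id1|].
    apply (continuity_1d_2d_pt_comp h (fun _ t => zeta + t)); auto.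
    apply continuity_2d_pt_plus; [apply continuity_2d_pt_const|apply continuity_2d_pt_id2]. }
  split; apply C; [apply continuity_cos|apply continuity_sin].
Qed.

Lemma rel_cont_polar (K G : R -> R -> Prop) zeta w r t :
  (forall r t, K r t -> G (r * cos (zeta + t)) (r * sin (zeta + t))) ->
  rel_cont G w (r * cos (zeta + t)) (r * sin (zeta + t)) ->
  rel_cont K (fun r t => w (r * cos (zeta + t)) (r * sin (zeta + t))) r t.
Proof.
  intros HK H e He. destruct (H e He) as [d [Hd D]].
  destruct (continuity_2d_polar zeta r t) as [C1 C2].
  destruct (C1 (mkposreal d Hd)) as [[d1 P1] D1]. destruct (C2 (mkposreal d Hd)) as [[d2 P2] D2].
  simpl in D1, D2. exists (Rmin d1 d2). split; [now apply Rmin_pos|]. intros r' t' k h1 h2.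
  pose proof (Rmin_l d1 d2). pose proof (Rmin_r d1 d2). apply D; [auto|apply D1; lra|apply D2; lra].
Qed.

Lemma cos_ge_of_abs_le a b : Rabs a <= b -> b <= PI -> cos b <= cos a.
Proof.
  intros H Hb. pose proof (Rabs_pos a).
  replace (cos a) with (cos (Rabs a)).
  - apply cos_decr_1; lra.
  - unfold Rabs. destruct (Rcase_abs a); auto. apply cos_neg.
Qed.

Definition sector (zeta phi x y : R) : Prop :=
  exists r t, 0 < r /\ Rabs t < phi / 2 /\ x = r * cos (zeta + t) /\ y = r * sin (zeta + t).

(** The strip is not compact, but the points where [F] is at least [F r0 t0] lie in a compact part
    of it. *)
Lemma strip_farthest_max phi (F : R -> R -> R) a b r0 t0 :
  let T := fun r t => 0 < r /\ Rabs t <= phi / 2 in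
  0 < a -> (forall r t, T r t -> rel_cont T F r t) -> T r0 t0 ->
  (forall r t, T r t -> F r0 t0 <= F r t -> a <= r <= b) ->
  exists r1 t1, T r1 t1 /\ (forall r t, T r t -> F r t <= F r1 t1) /\
    (forall r t, T r t -> F r t = F r1 t1 -> r <= r1).
Proof.
  intros T Ha HF H0 Hab.
  set (K := fun r t => True /\ a <= r <= b /\ - (phi / 2) <= t <= phi / 2).
  assert (KT : forall r t, K r t -> T r t).
  { intros r t (_ & h1 & h2). split; [lra|]. now apply Rabs_le_between. }
  assert (TK : forall r t, T r t -> F r0 t0 <= F r t -> K r t).
  { intros r t k h. pose proof (Hab r t k h). destruct k as [_ k]. apply Rabs_le_between in k.
    unfold K. tauto. }
  assert (CK : closed2 K).
  { apply (closed2_rect (fun _ _ => True)). intros x y N. tauto. }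
  assert (HK : forall r t, K r t -> a <= r <= b /\ - (phi / 2) <= t <= phi / 2) by (unfold K; tauto).
  destruct (closed_max a b (- (phi / 2)) (phi / 2) K F) as (r1 & t1 & K1 & M1); auto.
  { intros r t k e He. destruct (HF r t (KT _ _ k) e He) as [d [Hd D]]. exists d; split; auto.
    intros r' t' k' h1 h2. specialize (D r' t' (KT _ _ k') h1 h2). apply Rabs_lt_between in D. lra. }
  { exists r0, t0. apply TK; auto. lra. }
  assert (G1 : forall r t, T r t -> F r t <= F r1 t1).
  { intros r t k. destruct (Rle_or_lt (F r0 t0) (F r t)) as [h|h].
    - apply M1, TK; auto.
    - specialize (M1 r0 t0 (TK _ _ H0 (Rle_refl _))). lra. }
  (* The maximum points form a closed set, in which [r] is maximized. *)
  destruct (closed_max a b (- (phi / 2)) (phi / 2) (fun r t => K r t /\ F r t = F r1 t1)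
    (fun r _ => r)) as (r2 & t2 & [K2 E2] & M2).
  { intros r t [k _]. auto. }
  { intros r t N. destruct (classic (K r t)) as [k|k].
    - assert (h : F r t < F r1 t1).
      { destruct (G1 r t (KT _ _ k)) as [|E]; auto. exfalso; auto. }
      destruct (HF r t (KT _ _ k) (F r1 t1 - F r t) ltac:(lra)) as [d [Hd D]].
      exists d; split; auto. intros r' t' h1 h2 [k' E].
      specialize (D r' t' (KT _ _ k') h1 h2). apply Rabs_lt_between in D. lra.
    - destruct (CK r t k) as [d [Hd D]]. exists d; split; auto.
      intros r' t' h1 h2 [k' _]. now apply (D r' t'). }
  { intros r t _ e He. exists e; split; auto. intros r' t' _ h1 _. apply Rabs_lt_between in h1. lra. }
  { exists r1, t1. auto. }
  exists r2, t2. split; [auto|]. rewrite E2. split; auto.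
  intros r t k E. apply (M2 r t). split; auto. apply TK; auto. rewrite E. apply G1; auto.
Qed.

(** The hypotheses bound the modulus although only [u] is estimated, because the barrier rotates
    values. The vertex, where the logarithm in the barrier breaks down, is replaced by a bound for
    small [r]. *)
Lemma phragmen_lindelof u v zeta phi alpha sigma M B R0 :
  let T := fun r t => 0 < r /\ Rabs t <= phi / 2 in
  let U := fun r t => u (r * cos (zeta + t)) (r * sin (zeta + t)) in
  let V := fun r t => v (r * cos (zeta + t)) (r * sin (zeta + t)) in
  0 < phi < 2 * PI -> phi <= PI / alpha -> 0 < sigma < alpha -> 0 <= M -> 0 <= B ->
  open2 (sector zeta phi) ->
  (forall x y, sector zeta phi x y -> holo u v x y) ->
  (forall r t, T r t -> rel_cont T U r t /\ rel_cont T V r t) ->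
  (forall e, 0 < e -> exists d, 0 < d /\ forall r t, T r t -> r < d -> cmod (U r t) (V r t) <= M + e) ->
  (forall r t, 0 < r -> Rabs t = phi / 2 -> cmod (U r t) (V r t) <= M) ->
  (forall r t, T r t -> R0 < r -> cmod (U r t) (V r t) <= B * exp (exp (sigma * ln r))) ->
  forall x y, sector zeta phi x y -> u x y <= M.
Proof.
  intros T U V Hphi Ha Hs HM HB HO Hf HC Hz Hb Hg x y (r0 & t0 & Hr0 & Ht0 & -> & ->).
  change (U r0 t0 <= M). apply Rnot_lt_le. intros Hbig.
  set (bet := (sigma + alpha) / 2).
  assert (Hbet : sigma < bet < alpha) by (unfold bet; lra).
  pose proof PI_RGT_0 as Hpi.
  (* The strict inequality [bet < alpha] keeps the real part of the rotated power above [c] times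
     [r^bet], with [c > 0], up to the bounding rays. *)
  assert (Hang : bet * (phi / 2) < PI / 2).
  { apply Rle_lt_trans with (bet * (PI / alpha / 2)); [apply Rmult_le_compat_l; lra|].
    replace (bet * (PI / alpha / 2)) with (PI / 2 * (bet / alpha)) by (field; lra).
    replace (PI / 2) with (PI / 2 * 1) at 2 by ring. apply Rmult_lt_compat_l; [lra|].
    apply Rmult_lt_reg_r with alpha; [lra|]. unfold Rdiv. rewrite Rmult_assoc, Rinv_l; lra. }
  set (c := cos (bet * (phi / 2))).
  assert (Hc : 0 < c) by (apply cos_gt_0; [|lra]; assert (0 < bet * (phi / 2)) by nra; lra).
  assert (Hcos : forall t, Rabs t <= phi / 2 -> c <= cos (bet * t)).
  { intros t Ht. apply cos_ge_of_abs_le; [|lra]. rewrite Rabs_mult, (Rabs_pos_eq bet) by lra.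
    apply Rmult_le_compat_l; lra. }
  assert (TPI : forall r t, T r t -> Rabs t < PI) by (intros r t [_ h]; lra).
  assert (T0 : T r0 t0) by (split; lra).
  (* The barrier tends to 1 as [del] tends to 0, so for some [del > 0] the product still exceeds [M]
     at the chosen point. *)
  assert (exists del, 0 < del /\
    M < U r0 t0 * (exp (- del * (exp (bet * ln r0) * cos (bet * t0))) *
                   cos (- del * (exp (bet * ln r0) * sin (bet * t0)))) -
        V r0 t0 * (exp (- del * (exp (bet * ln r0) * cos (bet * t0))) *
                   sin (- del * (exp (bet * ln r0) * sin (bet * t0))))) as (del & Hdel & Hlow).
  { set (p := exp (bet * ln r0) * cos (bet * t0)). set (q := exp (bet * ln r0) * sin (bet * t0)).
    set (g := fun del => U r0 t0 * (exp (- del * p) * cos (- del * q)) -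
                         V r0 t0 * (exp (- del * p) * sin (- del * q))).
    assert (Cg : continuous g 0).
    { apply (ex_derive_continuous (K := R_AbsRing) (V := R_NormedModule)). unfold g. auto_derive. auto. }
    apply continuity_pt_filterlim in Cg.
    assert (g0 : g 0 = U r0 t0).
    { unfold g. rewrite Ropp_0, !Rmult_0_l, exp_0, cos_0, sin_0. ring. }
    destruct (Cg (U r0 t0 - M) ltac:(lra)) as [d [Hd D]].
    exists (d / 2). split; [lra|]. fold (g (d / 2)).
    specialize (D (d / 2)). simpl in D. unfold R_dist in D. rewrite g0, Rminus_0_r in D.
    assert (Rabs (g (d / 2) - U r0 t0) < U r0 t0 - M) as D'.
    { apply D. split; [split; [exact I|lra]|]. rewrite Rabs_pos_eq; lra. }
    apply Rabs_lt_between in D'. lra. }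
  destruct (holo_barrier zeta del bet) as (w1 & w2 & Hw).
  set (H := fun x y => u x y * w1 x y - v x y * w2 x y).
  set (F := fun r t => H (r * cos (zeta + t)) (r * sin (zeta + t))).
  assert (EF : forall r t, T r t -> F r t =
    U r t * (exp (- del * (exp (bet * ln r) * cos (bet * t))) *
                   cos (- del * (exp (bet * ln r) * sin (bet * t)))) -
    V r t * (exp (- del * (exp (bet * ln r) * cos (bet * t))) *
                   sin (- del * (exp (bet * ln r) * sin (bet * t))))).
  { intros r t k. destruct (Hw r t (proj1 k) (TPI r t k)) as (_ & W1 & W2).
    unfold F, H, U, V. now rewrite W1, W2. }
  assert (BF : forall r t, T r t -> F r t <= cmod (U r t) (V r t) * exp (- (del * c * exp (bet * ln r)))).
  { intros r t k. rewrite (EF r t k).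
    eapply Rle_trans; [apply re_rotated_le; left; apply exp_pos|].
    apply Rmult_le_compat_l; [apply cmod_pos|].
    assert (- del * (exp (bet * ln r) * cos (bet * t)) <= - (del * c * exp (bet * ln r))) as Q.
    { pose proof (exp_pos (bet * ln r)). specialize (Hcos t (proj2 k)).
      assert (0 <= del * exp (bet * ln r) * (cos (bet * t) - c)); [|lra].
      apply Rmult_le_pos; [nra|lra]. }
    destruct Q as [Q|Q]; [left; now apply exp_increasing|rewrite Q; lra]. }
  assert (BF1 : forall r t, T r t -> F r t <= cmod (U r t) (V r t)).
  { intros r t k. eapply Rle_trans; [apply BF; auto|].
    rewrite <- (Rmult_1_r (cmod _ _)) at 2. apply Rmult_le_compat_l; [apply cmod_pos|].
    rewrite <- exp_0. left. apply exp_increasing. pose proof (exp_pos (bet * ln r)).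
    assert (0 < del * c * exp (bet * ln r)) by (apply Rmult_lt_0_compat; nra). lra. }
  assert (F0 : M < F r0 t0) by (rewrite (EF r0 t0 T0); exact Hlow).
  assert (CF : forall r t, T r t -> rel_cont T F r t).
  { intros r t k. destruct (HC r t k) as [CU CV].
    destruct (Hw r t (proj1 k) (TPI r t k)) as ((C1 & C2 & _) & _).
    apply (rel_cont_re_mult T U V (fun r t => w1 (r * cos (zeta + t)) (r * sin (zeta + t)))
      (fun r t => w2 (r * cos (zeta + t)) (r * sin (zeta + t)))); auto;
      apply (rel_cont_polar _ (fun _ _ => True)); auto; now apply rel_cont_continuous. }
  destruct (Hz ((F r0 t0 - M) / 2) ltac:(lra)) as [d [Hd D]].
  destruct (exp_damping sigma bet (del * c) (F r0 t0) B) as [R1 [HR1 HD]];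
    [lra|lra|nra|lra|lra|].
  (* The superlevel set stays away from the vertex, where [F] is close to or below [M], and from
     infinity, where the barrier beats the growth. *)
  destruct (strip_farthest_max phi F d (Rmax R0 R1) r0 t0 Hd CF T0) as (r1 & t1 & T1 & M1 & M2).
  { intros r t k h. split.
    - apply Rnot_lt_le. intros hr. specialize (D r t k hr). specialize (BF1 r t k). lra.
    - apply Rnot_lt_le. intros hr. pose proof (Rmax_l R0 R1). pose proof (Rmax_r R0 R1).
      specialize (HD r ltac:(lra)). specialize (Hg r t k ltac:(lra)). specialize (BF r t k).
      assert (cmod (U r t) (V r t) * exp (- (del * c * exp (bet * ln r))) <=
        B * exp (exp (sigma * ln r)) * exp (- (del * c * exp (bet * ln r)))).
      { apply Rmult_le_compat_r; auto. left. apply exp_pos. }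
      lra. }
  (* On the bounding rays [F <= M < F r0 t0], so the maximum point is interior. *)
  assert (Ht1 : Rabs t1 < phi / 2).
  { destruct T1 as [h1 h2]. destruct h2 as [h2|h2]; auto. exfalso.
    specialize (Hb r1 t1 h1 h2). specialize (BF1 r1 t1 (conj h1 (Req_le _ _ h2))).
    specialize (M1 r0 t0 T0). lra. }
  apply (holo_no_farthest_max H (fun x y => u x y * w2 x y + v x y * w1 x y) (sector zeta phi)
    (r1 * cos (zeta + t1)) (r1 * sin (zeta + t1))); auto.
  - intros x y k. pose proof k as (r & t & Hr & Ht & -> & ->). apply holo_mult; auto.
    apply Hw; auto. lra.
  - exists r1, t1. destruct T1. auto.
  - intros x y (r & t & Hr & Ht & -> & ->). assert (k : T r t) by (split; lra).
    split; [exact (M1 r t k)|]. intros E. rewrite !polar_norm.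
    apply pow_incr. split; [lra|]. apply (M2 r t k E).
Qed.

(** * Restriction to a slice *)

Definition qdot (p q : quat) : R := qr p * qr q + qi p * qi q + qj p * qj q + qk p * qk q.

(** Solved for [qi I ^ 2], so that [ring] can take it as a rewriting rule. *)
Lemma in_S_norm I : in_S I -> qr I = 0 /\ qi I ^ 2 = 1 - qj I ^ 2 - qk I ^ 2.
Proof. intros [H1 H2]. split; [auto|lra]. Qed.

Lemma qdot_mul_unit I p q : in_S I -> qdot (qmul I p) (qmul I q) = qdot p q.
Proof.
  intros H. destruct (in_S_norm I H) as [H1 H2]. unfold qdot, qmul; simpl. rewrite H1. ring [H2].
Qed.

Lemma qdot_mul_skew I p q : in_S I -> qdot (qmul I p) q = - qdot p (qmul I q).
Proof.
  intros H. destruct (in_S_norm I H) as [H1 H2]. unfold qdot, qmul; simpl. rewrite H1. ring.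
Qed.

Lemma qnorm_pos p : 0 <= qnorm p.
Proof. apply sqrt_pos. Qed.

Lemma qnorm_sqr p : qnorm p ^ 2 = qdot p p.
Proof.
  unfold qnorm. rewrite pow2_sqrt.
  - unfold qdot. ring.
  - pose proof (pow2_ge_0 (qr p)). pose proof (pow2_ge_0 (qi p)).
    pose proof (pow2_ge_0 (qj p)). pose proof (pow2_ge_0 (qk p)). lra.
Qed.

(* Bessel's inequality for the orthogonal pair [w], [I w]. *)
Lemma cmod_qdot_le I p w : in_S I -> cmod (qdot p w) (qdot p (qmul I w)) <= qnorm p * qnorm w.
Proof.
  intros HI. pose proof (qnorm_pos p). pose proof (qnorm_pos w).
  unfold cmod. rewrite <- (sqrt_pow2 (qnorm p * qnorm w)) by nra. apply sqrt_le_1_alt.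
  rewrite Rpow_mult_distr, !qnorm_sqr. destruct HI as [H1 H2].
  (* [c1], [c2], [c3] are the imaginary components of [p conj(w)]. *)
  set (c1 := - qr p * qi w + qi p * qr w - qj p * qk w + qk p * qj w).
  set (c2 := - qr p * qj w + qi p * qk w + qj p * qr w - qk p * qi w).
  set (c3 := - qr p * qk w - qi p * qj w + qj p * qi w + qk p * qr w).
  assert (E : qdot p p * qdot w w = qdot p w ^ 2 + (c1 ^ 2 + c2 ^ 2 + c3 ^ 2))
    by (unfold qdot, c1, c2, c3; ring).
  assert (E2 : qdot p (qmul I w) = qi I * c1 + qj I * c2 + qk I * c3)
    by (unfold qdot, qmul, c1, c2, c3; simpl; rewrite H1; ring).
  rewrite E, E2.
  assert ((qi I * c1 + qj I * c2 + qk I * c3) ^ 2 +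
    ((qi I * c2 - qj I * c1) ^ 2 + (qi I * c3 - qk I * c1) ^ 2 + (qj I * c3 - qk I * c2) ^ 2) =
    (qi I ^ 2 + qj I ^ 2 + qk I ^ 2) * (c1 ^ 2 + c2 ^ 2 + c3 ^ 2)) as L by ring.
  rewrite H2 in L. pose proof (pow2_ge_0 (qi I * c2 - qj I * c1)).
  pose proof (pow2_ge_0 (qi I * c3 - qk I * c1)). pose proof (pow2_ge_0 (qj I * c3 - qk I * c2)). lra.
Qed.

(** Cauchy-Schwarz, read off from Bessel's inequality with an arbitrary unit. *)
Lemma qdot_le p w : Rabs (qdot p w) <= qnorm p * qnorm w.
Proof.
  pose proof (cmod_qdot_le (mkQ 0 1 0 0) p w ltac:(unfold in_S; simpl; lra)) as H.
  eapply Rle_trans; [|exact H]. unfold cmod. rewrite <- sqrt_Rsqr_abs. apply sqrt_le_1_alt.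
  unfold Rsqr. pose proof (pow2_ge_0 (qdot p (qmul (mkQ 0 1 0 0) w))). lra.
Qed.

Lemma qdot_sub p p' w : qdot (qsub p p') w = qdot p w - qdot p' w.
Proof. unfold qdot, qsub, qadd, qopp; simpl. ring. Qed.

Lemma derivable_pt_lim_qdot h t d w :
  qderiv h t d -> derivable_pt_lim (fun s => qdot (h s) w) t (qdot d w).
Proof.
  intros (H1 & H2 & H3 & H4).
  assert (S : forall g l k, derivable_pt_lim g t l -> derivable_pt_lim (fun s => g s * k) t (l * k)).
  { intros g l k H. eapply derivable_pt_lim_eq;
      [exact (derivable_pt_lim_mult g (fun _ => k) t _ _ H (derivable_pt_lim_const k t))|cbv beta; ring]. }
  unfold qdot. repeat apply derivable_pt_lim_plus; apply S; auto.
Qed.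

Lemma slice_pt_norm I x y : in_S I -> qnorm (slice_pt I x y) = sqrt (x ^ 2 + y ^ 2).
Proof.
  intros HI. destruct (in_S_norm I HI) as [H1 H2]. unfold qnorm, slice_pt, qadd, qofR, qscal; simpl.
  f_equal. rewrite H1. ring [H2].
Qed.

Lemma slice_pt_inj I x y x' y' : in_S I -> slice_pt I x y = slice_pt I x' y' -> x = x' /\ y = y'.
Proof.
  intros [H1 H2] E. unfold slice_pt, qadd, qofR, qscal in E; simpl in E. rewrite H1 in E.
  injection E as E0 E1 E2 E3. split; [lra|].
  (* [y] is recovered as the inner product of the imaginary part with [I]. *)
  replace y with ((0 + y * qi I) * qi I + (0 + y * qj I) * qj I + (0 + y * qk I) * qk I)
    by (replace y with (y * (qi I ^ 2 + qj I ^ 2 + qk I ^ 2)) at 4 by (rewrite H2; ring); ring).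
  rewrite E1, E2, E3.
  replace y' with (y' * (qi I ^ 2 + qj I ^ 2 + qk I ^ 2)) at 4 by (rewrite H2; ring). ring.
Qed.

Lemma sqrt_sum_sqr_le a b : sqrt (a ^ 2 + b ^ 2) <= Rabs a + Rabs b.
Proof.
  pose proof (Rabs_pos a). pose proof (Rabs_pos b).
  rewrite <- (sqrt_pow2 (Rabs a + Rabs b)) by lra. apply sqrt_le_1_alt.
  rewrite <- (pow2_abs a), <- (pow2_abs b). nra.
Qed.

Lemma slice_pt_dist_le I x y x' y' : in_S I ->
  qdist (slice_pt I x y) (slice_pt I x' y') <= Rabs (x - x') + Rabs (y - y').
Proof.
  intros HI. eapply Rle_trans; [|apply sqrt_sum_sqr_le].
  rewrite <- slice_pt_norm with (I := I) by auto. right. unfold qdist. f_equal.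
  unfold slice_pt, qsub, qadd, qofR, qopp, qscal; simpl. f_equal; ring.
Qed.

Lemma slice_pt_surj q : exists I x y, in_S I /\ q = slice_pt I x y.
Proof.
  destruct q as [a b c d]. set (n2 := b ^ 2 + c ^ 2 + d ^ 2).
  assert (0 <= n2).
  { unfold n2. pose proof (pow2_ge_0 b). pose proof (pow2_ge_0 c). pose proof (pow2_ge_0 d). lra. }
  destruct (Req_dec n2 0) as [Z|Z].
  (* A real quaternion lies in every slice, so any unit will do. *)
  - exists (mkQ 0 1 0 0), a, 0. split; [unfold in_S; simpl; lra|].
    unfold slice_pt, qadd, qofR, qscal; simpl. unfold n2 in Z.
    pose proof (pow2_ge_0 b). pose proof (pow2_ge_0 c). pose proof (pow2_ge_0 d). f_equal; nra.
  - set (n := sqrt n2). assert (Hn : n * n = n2) by now apply sqrt_sqrt.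
    assert (n <> 0) by (intros E; rewrite E in Hn; lra).
    exists (mkQ 0 (b / n) (c / n) (d / n)), a, n. split.
    + split; simpl; auto.
      replace (b / n * (b / n * 1) + c / n * (c / n * 1) + d / n * (d / n * 1)) with (n2 / (n * n))
        by (unfold n2; field; auto).
      rewrite Hn. field. auto.
    + unfold slice_pt, qadd, qofR, qscal; simpl. f_equal; field; auto.
Qed.

Lemma closure_incl Om q : Om q -> closure Om q.
Proof.
  intros H e He. exists q. split; auto. unfold qdist, qnorm, qsub, qadd, qopp; simpl.
  replace (_ + _ + _ + _) with 0 by ring. now rewrite sqrt_0.
Qed.

Lemma le_exp_of_lnp_le x z : 0 <= z -> lnp x <= z -> x <= exp z.
Proof.
  intros Hz. unfold lnp. pose proof (exp_ineq1_le z). destruct (Rle_dec x 1) as [h|h]; intros H0; [lra|].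
  rewrite <- (exp_ln x) by lra. destruct H0 as [H0|H0]; [left; now apply exp_increasing|rewrite H0; lra].
Qed.

Lemma continuity_2d_cmod a b : continuity_2d_pt cmod a b.
Proof.
  apply (continuity_1d_2d_pt_comp sqrt (fun a b => a ^ 2 + b ^ 2)).
  - apply continuity_pt_sqrt. pose proof (pow2_ge_0 a). pose proof (pow2_ge_0 b). lra.
  - apply continuity_2d_pt_plus; apply continuity_2d_pt_pow2;
      [apply continuity_2d_pt_id1|apply continuity_2d_pt_id2].
Qed.

Lemma order_bound f Om rho alpha : has_order f Om rho -> rho < alpha -> 0 < alpha ->
  exists sigma R0, 0 < sigma < alpha /\ forall q, closure Om q -> R0 < qnorm q ->
    qnorm (f q) <= exp (exp (sigma * ln (qnorm q))).
Proof.
  (* [Rmax rho 0] makes [sigma] positive whatever the sign of [rho]. *)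
  intros [Mf [HM [HL _]]] Hr Ha. set (sigma := (Rmax rho 0 + alpha) / 2).
  assert (Rmax rho 0 < alpha) by (apply Rmax_lub_lt; auto).
  pose proof (Rmax_l rho 0). pose proof (Rmax_r rho 0).
  destruct (HL (sigma - rho)) as [R0 HR0]; [unfold sigma; lra|].
  (* Beyond 1 the logarithm is positive, so the bound on the quotient can be multiplied out. *)
  exists sigma, (Rmax R0 1). split; [unfold sigma; lra|]. intros q Hq Hn.
  pose proof (Rmax_l R0 1). pose proof (Rmax_r R0 1).
  set (r := qnorm q) in *. specialize (HR0 r ltac:(lra)).
  replace (rho + (sigma - rho)) with sigma in HR0 by ring.
  assert (Hl : 0 < ln r) by (rewrite <- ln_1; apply ln_increasing; lra).
  assert (Hlt : lnp (lnp (Mf r)) < sigma * ln r).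
  { replace (lnp (lnp (Mf r))) with (lnp (lnp (Mf r)) / ln r * ln r) by (field; lra).
    apply Rmult_lt_compat_r; auto. }
  assert (0 < sigma) by (unfold sigma; lra).
  apply Rle_trans with (Mf r); [apply (HM r ltac:(lra)); auto|].
  apply le_exp_of_lnp_le; [left; apply exp_pos|]. apply le_exp_of_lnp_le; nra.
Qed.

Lemma open_slice Om I : is_open r2dist (fun p : R * R => Om (slice_pt I (fst p) (snd p))) ->
  open2 (fun x y => Om (slice_pt I x y)).
Proof.
  intros H x y k. destruct (H (x, y) k) as [e [He HH]]. exists (e / 2). split; [lra|].
  intros x' y' h1 h2. apply (HH (x', y')). unfold r2dist; simpl.
  rewrite Rabs_minus_sym in h1, h2. pose proof (sqrt_sum_sqr_le (x - x') (y - y')) as S.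
  simpl in S. lra.
Qed.

Lemma rel_cont_slice Om f I w x y : in_S I -> continuous_on (closure Om) f ->
  closure Om (slice_pt I x y) ->
  rel_cont (fun x y => closure Om (slice_pt I x y)) (fun x y => qdot (f (slice_pt I x y)) w) x y.
Proof.
  intros HI Hf k e He. pose proof (qnorm_pos w) as Hw.
  destruct (Hf _ k (e / (qnorm w + 1)) ltac:(apply Rdiv_lt_0_compat; lra)) as [d [Hd D]].
  exists (d / 2). split; [lra|]. intros x' y' k' h1 h2.
  specialize (D _ k' ltac:(eapply Rle_lt_trans; [now apply slice_pt_dist_le|lra])).
  rewrite <- qdot_sub. eapply Rle_lt_trans; [apply qdot_le|].
  fold (qdist (f (slice_pt I x' y')) (f (slice_pt I x y))).
  replace e with (e / (qnorm w + 1) * (qnorm w + 1)) by (field; lra).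
  assert (0 <= qdist (f (slice_pt I x' y')) (f (slice_pt I x y))) by apply qnorm_pos. nra.
Qed.

(** Slice regularity says [dx = - I dy]. Left multiplication by [I] is a skew isometry, so
    [<dy, w> = <I dy, I w> = - <dx, I w>] and [<dy, I w> = - <I dy, w> = <dx, w>], which are the
    Cauchy-Riemann equations. *)
Lemma holo_slice Om f I w x y : in_S I -> slice_regular Om f -> continuous_on (closure Om) f ->
  open2 (fun x y => Om (slice_pt I x y)) -> Om (slice_pt I x y) ->
  holo (fun x y => qdot (f (slice_pt I x y)) w) (fun x y => qdot (f (slice_pt I x y)) (qmul I w)) x y.
Proof.
  intros HI [_ Hr] Hc HO k.
  assert (C : forall z, continuity_2d_pt (fun x y => qdot (f (slice_pt I x y)) z) x y).
  { intros z [e He]. destruct (HO x y k) as [r [Pr Hb]].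
    destruct (rel_cont_slice Om f I z x y HI Hc (closure_incl _ _ k) e He) as [d [Pd D]].
    exists (mkposreal (Rmin r d) (Rmin_pos _ _ Pr Pd)). simpl. intros x' y' h1 h2.
    pose proof (Rmin_l r d). pose proof (Rmin_r r d).
    apply D; try lra. apply closure_incl, Hb; lra. }
  split; [apply C|split; [apply C|]].
  destruct (Hr I HI x y k) as (dx & dy & Dx & Dy & E).
  assert (Edx : dx = qopp (qmul I dy)).
  { destruct dx as [a b c d]. unfold qscal, qadd, qzero in E. simpl in E.
    injection E as E0 E1 E2 E3. unfold qopp, qmul; simpl. f_equal; lra. }
  assert (N : forall p z, qdot (qopp p) z = - qdot p z) by (intros; unfold qdot, qopp; simpl; ring).
  exists (qdot dx w), (qdot dx (qmul I w)). repeat split.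
  - now apply (derivable_pt_lim_qdot (fun s => f (slice_pt I s y))).
  - eapply derivable_pt_lim_eq; [apply (derivable_pt_lim_qdot (fun s => f (slice_pt I x s)) y dy w Dy)|].
    rewrite Edx, N, qdot_mul_unit by auto. ring.
  - now apply (derivable_pt_lim_qdot (fun s => f (slice_pt I s y))).
  - eapply derivable_pt_lim_eq;
      [apply (derivable_pt_lim_qdot (fun s => f (slice_pt I x s)) y dy (qmul I w) Dy)|].
    rewrite Edx, N, qdot_mul_skew by auto. ring.
Qed.

(** A point of a bounding ray is approached by contracting its angle to [t * (1 - m)], which lies
    strictly inside. *)
Lemma sector_closure Om I zeta phi r t : in_S I -> 0 < phi ->
  (forall x y, sector zeta phi x y -> Om (slice_pt I x y)) ->
  0 < r -> Rabs t <= phi / 2 -> closure Om (slice_pt I (r * cos (zeta + t)) (r * sin (zeta + t))).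
Proof.
  intros HI Hphi HOm Hr Ht e He.
  destruct (continuity_2d_polar zeta r t) as [C1 C2].
  destruct (C1 (mkposreal (e / 2) ltac:(lra))) as [[d1 P1] D1].
  destruct (C2 (mkposreal (e / 2) ltac:(lra))) as [[d2 P2] D2]. simpl in D1, D2.
  set (m := Rmin 1 (Rmin d1 d2 / (phi + 1))).
  assert (Hd : 0 < Rmin d1 d2) by now apply Rmin_pos.
  assert (Hm : 0 < m) by (apply Rmin_pos; [lra|apply Rdiv_lt_0_compat; lra]).
  assert (m <= 1 /\ m * (phi + 1) <= Rmin d1 d2) as [Hm1 Hm2].
  { split; [apply Rmin_l|]. replace (Rmin d1 d2) with (Rmin d1 d2 / (phi + 1) * (phi + 1)) by (field; lra).
    apply Rmult_le_compat_r; [lra|apply Rmin_r]. }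
  set (t' := t * (1 - m)).
  assert (Ht' : Rabs t' < phi / 2).
  { unfold t'. rewrite Rabs_mult, (Rabs_pos_eq (1 - m)) by lra. nra. }
  assert (Hdt : Rabs (t' - t) < Rmin d1 d2).
  { unfold t'. replace (t * (1 - m) - t) with (- (t * m)) by ring.
    rewrite Rabs_Ropp, Rabs_mult, (Rabs_pos_eq m) by lra. nra. }
  exists (slice_pt I (r * cos (zeta + t')) (r * sin (zeta + t'))). split.
  { apply HOm. exists r, t'. auto. }
  pose proof (Rmin_l d1 d2). pose proof (Rmin_r d1 d2).
  specialize (D1 r t' ltac:(rewrite Rminus_diag, Rabs_R0; lra) ltac:(lra)).
  specialize (D2 r t' ltac:(rewrite Rminus_diag, Rabs_R0; lra) ltac:(lra)).
  eapply Rle_lt_trans; [now apply slice_pt_dist_le|lra].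
Qed.

Theorem theorem4p4 (Om : quat -> Prop) (alpha : R) (f : quat -> quat) (M : R) :
  0 < alpha ->
  angular_domain Om (PI / alpha) ->
  slice_regular Om f ->
  continuous_on (closure Om) f ->
  (exists rho, has_order f Om rho /\ rho < alpha) ->
  0 <= M ->
  (forall q, boundary Om q -> qnorm (f q) <= M) ->
  forall q, Om q -> qnorm (f q) <= M.
Proof.
  intros Ha [[_ [_ Hslice]] (zeta & phi & Hphi & Hsec & Hlub)] Hreg Hcont [rho [Hord Hrho]] HM Hbd q0 Hq0.
  destruct (slice_pt_surj q0) as (I & x0 & y0 & HI & ->).
  set (w := f (slice_pt I x0 y0)) in *.
  destruct (Req_dec (qnorm w) 0) as [Hw|Hw]; [lra|].
  pose proof (qnorm_pos w) as Hw0.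
  destruct (order_bound f Om rho alpha Hord Hrho Ha) as (sigma & R0 & Hsig & Hgrow).
  assert (HO : open2 (fun x y => Om (slice_pt I x y))) by (apply open_slice; apply Hslice; auto).
  set (z := zeta I). set (p := phi I).
  assert (Hp : 0 < p < 2 * PI) by (apply Hphi; auto).
  assert (S : forall x y, sector z p x y <-> Om (slice_pt I x y)).
  { intros x y. rewrite (Hsec I HI x y). split.
    - intros (r & t & Hr & Ht & -> & ->). exists r, t. auto.
    - intros (r & t & Hr & Ht & E). apply slice_pt_inj in E as [-> ->]; auto. exists r, t. auto. }
  assert (HSO : open2 (sector z p)).
  { intros x y k. apply S in k. destruct (HO x y k) as [r [Hr H]]. exists r. split; auto.
    intros. apply S. auto. }
  assert (HSC : forall r t, 0 < r /\ Rabs t <= p / 2 ->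
    closure Om (slice_pt I (r * cos (z + t)) (r * sin (z + t)))).
  { intros r t [Hr Ht]. apply (sector_closure Om I z p); try lra; auto. intros x y k. now apply S. }
  (* The vertex is a boundary point, so [|f| <= M] there, and continuity gives the bound required
     near it. *)
  assert (H0 : closure Om (slice_pt I 0 0)).
  { intros e He. exists (slice_pt I (e / 2 * cos (z + 0)) (e / 2 * sin (z + 0))). split.
    - apply S. exists (e / 2), 0. rewrite Rabs_R0. repeat split; lra.
    - apply Rle_lt_trans with (e / 2); [right|lra].
      transitivity (sqrt ((e / 2 * cos (z + 0)) ^ 2 + (e / 2 * sin (z + 0)) ^ 2)).
      + rewrite <- slice_pt_norm with (I := I) by auto. unfold qdist. f_equal.
        unfold slice_pt, qsub, qadd, qofR, qopp, qscal; simpl. f_equal; ring.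
      + rewrite polar_norm. apply sqrt_pow2. lra. }
  assert (H0' : ~ Om (slice_pt I 0 0)).
  { intros k. apply S in k as (r & t & Hr & _ & E1 & E2).
    pose proof (polar_norm r (z + t)) as N. rewrite <- E1, <- E2 in N.
    assert (0 < r ^ 2) by (apply pow_lt; auto). lra. }
  set (u := fun x y => qdot (f (slice_pt I x y)) w).
  set (v := fun x y => qdot (f (slice_pt I x y)) (qmul I w)).
  assert (Hle : forall x y m, qnorm (f (slice_pt I x y)) <= m -> cmod (u x y) (v x y) <= m * qnorm w).
  { intros x y m Hm. eapply Rle_trans; [apply cmod_qdot_le; auto|]. now apply Rmult_le_compat_r. }
  assert (PL : u x0 y0 <= M * qnorm w).
  { apply (phragmen_lindelof u v z p alpha sigma (M * qnorm w) (qnorm w) R0); auto.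
    - apply Hlub. exists I. auto.
    - nra.
    - intros x y k. apply (holo_slice Om f I w); auto. now apply S.
    - intros r t k. split; apply (rel_cont_polar _ (fun x y => closure Om (slice_pt I x y))); auto;
        apply rel_cont_slice; auto.
    - intros e He.
      assert (C : rel_cont (fun x y => closure Om (slice_pt I x y)) (fun x y => cmod (u x y) (v x y)) 0 0).
      { apply (rel_cont_comp2 _ u v cmod); try apply rel_cont_slice; auto. apply continuity_2d_cmod. }
      destruct (C e He) as [d [Hd D]]. exists d. split; auto. intros r t k hr.
      assert (B : forall c, -1 <= c <= 1 -> Rabs (r * c - 0) < d).
      { intros c hc. destruct k. rewrite Rminus_0_r, Rabs_mult, (Rabs_pos_eq r) by lra.
        assert (Rabs c <= 1) by now apply Rabs_le_between. nra. }
      specialize (D _ _ (HSC r t k) (B _ (COS_bound _)) (B _ (SIN_bound _))).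
      pose proof (Hle 0 0 M (Hbd _ (conj H0 H0'))). apply Rabs_lt_between in D. lra.
    (* As [p / 2 < PI], [arg] recovers the angle from the point, so a bounding ray cannot reenter
       the sector. *)
    - intros r t Hr Ht. apply Hle, Hbd. split; [apply HSC; lra|]. intros k.
      apply S in k as (r' & t' & Hr' & Ht' & E1 & E2).
      pose proof (arg_polar z r t Hr ltac:(lra)) as A. rewrite E1, E2, arg_polar in A by lra.
      rewrite A in Ht'. lra.
    - intros r t k HrR. rewrite (Rmult_comm (qnorm w)).
      assert (Er : qnorm (slice_pt I (r * cos (z + t)) (r * sin (z + t))) = r).
      { rewrite slice_pt_norm, polar_norm by auto. apply sqrt_pow2. lra. }
      apply Hle. rewrite <- Er at 3. apply Hgrow; auto. now rewrite Er.
    - now apply S. }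
  (* At the given point the estimate reads [|w|^2 <= M |w|], and [|w|] cancels. *)
  change (u x0 y0) with (qdot w w) in PL. rewrite <- qnorm_sqr in PL.
  apply Rmult_le_reg_r with (qnorm w); [lra|]. simpl in PL. lra.
Qed.
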